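(* Let $G$ be a $4$-self-hedrite whose symmetry group is $T$ or $T_d$. Then there exist integers $0\leq l\leq k$ with $k+l$ odd such that $G$ is isomorphic to $Med^{-1}(GC_{k,l}(Octahedron))$.
   Context: Plane graphs are finite connected graphs drawn on the plane (equivalently on the sphere $S^2$, the unbounded face being counted as a face), with edges meeting only at vertices; multiple edges are allowed, but faces of size $1$ are not. Isomorphisms of plane graphs are isomorphisms of maps on the sphere, orientation-reversing ones allowed. $p_j$ denotes the number of faces of size $j$, and $G^*$ is the dual of $G$. A plane graph is self-dual if it is isomorphic to its dual. A $4$-self-hedrite is a self-dual plane graph with vertices of degree $2,3$ or $4$ and faces of size $2,3$ or $4$ such that $p_2+p_3=4$. (By Euler's formula $2p_2+p_3=4$, so in fact $p_2=0$, $p_3=4$, and by self-duality it has vertices of degree $3$ and $4$ only, with exactly four of degree $3$.) The symmetry group of a plane graph is the group of all its automorphisms as a map on the sphere (incidence-preserving, vertices to vertices and faces to faces, orientation-reversing automorphisms included), realized as a finite subgroup of $O(3)$ up to conjugacy; $T$ and $T_d$ are the rotation group and the full isometry group of the regular tetrahedron. Medial graph: for a plane graph $G$, $Med(G)$ is the plane graph obtained by putting a vertex on each edge of $G$, two such vertices being joined by an edge whenever the corresponding edges of $G$ share a common vertex and are contained in a common face (consecutive edges around a corner). $Med(G)$ is $4$-regular and $Med(G)=Med(G^* )$. Conversely, the faces of any $4$-regular plane graph $G'$ split into two classes $\mathcal{F}_1(G')$, $\mathcal{F}_2(G')$ such that faces sharing an edge lie in different classes; for $j=1,2$ let $G_j$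 be the plane graph with vertex set $\mathcal{F}_j(G')$ and one edge for each vertex $v$ of $G'$, joining the two (opposite) faces of $\mathcal{F}_j(G')$ at $v$. Then $G_1$ and $G_2$ are dual to each other and $G'=Med(G_1)=Med(G_2)$. If $G_1$ and $G_2$ are isomorphic, one writes $Med^{-1}(G')=G_1\simeq G_2$; otherwise $Med^{-1}(G')$ is not defined. Goldberg-Coxeter construction for the Octahedron: let $(k,l)\neq(0,0)$ be nonnegative integers and $z=k+li\in\mathbb{Z}[i]$. Take the Cube (the dual of the Octahedron) and identify each of its six faces, in an orientation-preserving way, with the square in $\mathbb{C}$ with vertices $0,z,(1+i)z,iz$, carrying the trace of the standard unit-square tiling of $\mathbb{C}$ with vertex set $\mathbb{Z}[i]$. These tilings match along the edges of the Cube (neighbouring squares are related by a translation by an element of $\mathbb{Z}[i]$ composed with a rotation by a multiple of $90^\circ$), so they glue to a tiling of the surface of the Cube by quadrangles, whose vertices are the images of the points of $\mathbb{Z}[i]$; the eight vertices of the Cube have degree $3$ and all other vertices have degree $4$. $GC_{k,l}(Octahedron)$ is the plane graph dual to this quadrangulation. It is $4$-regular with $6(k^2+l^2)$ vertices, and its faces are eight triangles and otherwise quadrangles. *)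

(* Defs.v *)
From HB Require Import structures.
From mathcomp Require Import all_boot all_order all_algebra all_fingroup.
Set Implicit Arguments.
Unset Strict Implicit.
Unset Printing Implicit Defensive.
Import Order.TTheory GRing.Theory Num.Theory.

(** * Maps on the sphere *)

(* A graph drawn on an oriented surface, given by its darts (half-edges):
   [alpha] reverses a dart, and [sigma d] is the next dart counterclockwise
   around the origin of [d].  Vertices and edges are the orbits of [sigma] and
   [alpha].  The laws of a map are not bundled; see [plane_graph]. *)
Record cmap := CMap {
  dart :> finType;
  sigma : dart -> dart;
  alpha : dart -> dart
}.

Arguments sigma {_} _.
Arguments alpha {_} _.

Section Maps.
Variable G : cmap.

(* Next dart along the face to the left of [d], traversed counterclockwise. The
   faces are the orbits of [phi]; the dart [d] also stands for the corner of
   that face between [d] and [sigma d]. *)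
Definition phi (d : G) : G := finv sigma (alpha d).

Definition link : rel G := fun x y => (sigma x == y) || (alpha x == y).

Definition connected_map : Prop := 0 < #|G| /\ forall x y : G, connect link x y.

Definition euler_sphere : Prop :=
  fcard (@sigma G) predT + fcard phi predT = fcard (@alpha G) predT + 2.

(* The last field says that no face has size 1. *)
Record plane_graph : Prop := PlaneGraph {
  pg_sigma : injective (@sigma G);
  pg_alpha : involutive (@alpha G);
  pg_nofix : forall d : G, alpha d != d;
  pg_connected : connected_map;
  pg_euler : euler_sphere;
  pg_faces : forall d : G, phi d != d
}.

Definition vertex_degree (d : G) : nat := fingraph.order sigma d.
Definition face_size (d : G) : nat := fingraph.order phi d.

Definition num_faces (j : nat) : nat := fcard phi (order_set phi j).

(* The dart [d] becomes the dual dart crossing [d] from its left to its right. *)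
Definition dual : cmap := CMap phi (@alpha G).

End Maps.

Arguments phi {_} _.

(* [rev] tells whether the isomorphism reverses the orientation. *)
Definition is_iso (G H : cmap) (rev : bool) (f : G -> H) : Prop :=
  [/\ bijective f,
      forall d, f (alpha d) = alpha (f d)
    & forall d, if rev then sigma (f (sigma d)) = f d
                else f (sigma d) = sigma (f d)].

Definition isomorphic (G H : cmap) : Prop :=
  exists rev (f : G -> H), is_iso rev f.

Definition self_dual (G : cmap) : Prop := isomorphic G (dual G).

Definition self_hedrite4 (G : cmap) : Prop :=
  [/\ plane_graph G,
      self_dual G,
      forall d : G, 2 <= vertex_degree d <= 4,
      forall d : G, 2 <= face_size d <= 4
    & num_faces G 2 + num_faces G 3 = 4].

(** * Symmetry groups *)

Section PointGroups.
Local Open Scope ring_scope.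
Variable R : rcfType.

(* Vertices of a regular tetrahedron: four alternate vertices of the cube
   [-1, 1]^3. *)
Definition tetra_vertex (v : 'rV[R]_3) : Prop :=
  (forall j, v 0 j = 1 \/ v 0 j = -1) /\ \prod_j v 0 j = 1.

Definition Td_group (A : 'M[R]_3) : Prop :=
  A *m A^T = 1%:M /\ forall v, tetra_vertex v -> tetra_vertex (v *m A).

Definition T_group (A : 'M[R]_3) : Prop := Td_group A /\ \det A = 1.

(* The automorphisms of [G], orientation-reversing ones included, are realized
   as the subgroup [P] of O(3): the isomorphism [rho] sends the automorphisms
   preserving (reversing) the orientation to the isometries that do so.  As
   [rho] is arbitrary, [P] matters only up to conjugacy.  The orientation is
   kept along with the permutation of the darts, which does not determine it
   when all vertices have degree at most 2.  Permutations and row vectors both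
   compose from left to right. *)
Definition symmetry_group_is (G : cmap) (P : 'M[R]_3 -> Prop) : Prop :=
  exists rho : {perm G} -> bool -> 'M[R]_3,
  [/\ forall (f g : {perm G}) (b c : bool), is_iso b f -> is_iso c g ->
        rho (f * g)%g (b (+) c) = rho f b *m rho g c,
      forall (f g : {perm G}) (b c : bool), is_iso b f -> is_iso c g ->
        rho f b = rho g c -> f = g /\ b = c,
      forall (f : {perm G}) (b : bool), is_iso b f -> \det (rho f b) = (-1) ^+ b
    & forall A, P A <-> exists (f : {perm G}) (b : bool),
                          is_iso b f /\ rho f b = A].

End PointGroups.

(** * Inverse medial graph *)

(* [F], given by its corners, is one of the two classes of faces of [M] such
   that faces sharing an edge lie in different classes. *)
Definition face_class (M : cmap) (F : {set M}) : Prop :=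
  forall d : M, (phi d \in F) = (d \in F) /\ (alpha d \in F) = (d \notin F).

Section MedHalf.
Variables (M : cmap) (F : {set M}).

(* For 4-regular [M] and a class [F] of faces: the darts are the corners of the
   faces in [F].  The corner [d] of a face is the end, at that face, of the edge
   corresponding to the vertex at [d]; its other end is the opposite corner at
   this vertex.  Both functions below preserve [F], so that the default value
   of [insubd] is never used. *)
Definition half_dart : finType := {d : M | d \in F}.
Definition half_sigma (d : half_dart) : half_dart := insubd d (phi (val d)).
Definition half_alpha (d : half_dart) : half_dart :=
  insubd d (sigma (sigma (val d))).

Definition med_half : cmap := CMap half_sigma half_alpha.

End MedHalf.

(* [Med^-1(M)] is defined and isomorphic to [G]. *)
Definition is_med_inv (M G : cmap) : Prop :=
  exists F : {set M},
    [/\ face_class F,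
        isomorphic (med_half F) (med_half (~: F))
      & isomorphic G (med_half F)].

(** * Goldberg-Coxeter construction for the Octahedron *)

(* The Cube: vertices are the subsets of {0, 1, 2} (coordinates equal to 1 in
   [0, 1]^3), and [(v, j)] is the dart from [v] parallel to the j-th axis. Seen
   from outside, the three axes are in counterclockwise order at odd vertices,
   and in clockwise order at even ones. *)
Definition cube_dart : finType := ({set 'I_3} * 'I_3)%type.
Definition flip (v : {set 'I_3}) (j : 'I_3) : {set 'I_3} :=
  if j \in v then v :\ j else j |: v.
Definition cube_sigma (d : cube_dart) : cube_dart :=
  let: (v, j) := d in (v, if odd #|v| then ordS j else ord_pred j).
Definition cube_alpha (d : cube_dart) : cube_dart :=
  let: (v, j) := d in (flip v j, j).

Definition cube : cmap := CMap cube_sigma cube_alpha.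

Section GoldbergCoxeter.
Local Open Scope ring_scope.
Variables k l : nat.

Definition gauss : Type := (int * int)%type.
Definition mulI (w : gauss) : gauss := (- w.2, w.1).
Definition ipow (u : 'I_4) : gauss := iter u mulI (1, 0).

Definition z : gauss := (k%:Z, l%:Z).

(* Re and Im of [w] times the conjugate of [z]. *)
Definition along (w : gauss) : int := z.1 * w.1 + z.2 * w.2.
Definition across (w : gauss) : int := z.1 * w.2 - z.2 * w.1.

(* All points are multiplied by 2, so that the centres of the unit squares of
   the tiling are the Gaussian integers with both coordinates odd, and the
   square carrying the tiling has vertices 0, 2z, 2(1+i)z, 2iz. *)
Definition in_square (w : gauss) : bool :=
  let n := (k ^ 2 + l ^ 2)%N%:Z *+ 2 in
  [&& 0 <= along w, along w <= n, 0 <= across w & across w <= n].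

(* Centres in the square; the range of the enumeration is large enough to
   contain the whole square. *)
Definition centres : seq gauss :=
  let N := (2 * (k + l))%N in
  let range := [seq i%:Z - N%:Z | i <- iota 0 (2 * N).+1] in
  [seq w <- [seq (x, y) | x <- range, y <- range]
       | [&& odd `|w.1|%N, odd `|w.2|%N & in_square w]].

(* [(c, w, u)] is the side, directed along i^u and having the tile to its left,
   of the tile centred at [w] in the chart of [c].  This chart identifies the
   face of the Cube to the left of [c] with the square in such a way that [c]
   goes from 0 to [z]; thus each face has four charts, differing by rotations.
   Tiles that straddle an edge of the Cube belong to the face(s) containing
   their centre, which is never a vertex of the Cube. *)
Definition side : finType := (cube * seq_sub centres * 'I_4)%type.

(* Coordinate changes: to the next chart of the same face,
   w |-> -i (w - z), and, across the edge [c], w |-> z - w, the latter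
   identifying points of the common edge of the two faces. *)
Definition glue_step : rel side := fun x y =>
  let: (c, w, u) := x in
  let: (c', w', u') := y in
  [&& c' == phi c, val w' == - mulI (val w - z *+ 2) & u' == ord_pred u]
  || [&& across (val w) == 0, c' == alpha c, val w' == z *+ 2 - val w
       & u' == ordS (ordS u)].

Definition glue : rel side := fun x y => glue_step x y || glue_step y x.

(* Darts of the quadrangulation: glueing classes of sides. *)
Definition quad_dart : finType := {x : side | x \in roots glue}.

Lemma glue_connect_sym : connect_sym glue.
Proof. by apply: sym_connect_sym => x y; rewrite /glue orbC. Qed.

Definition quad_class (x : side) : quad_dart :=
  exist _ (fingraph.root glue x) (roots_root glue_connect_sym x).

(* [y] is the side [x], reversed, of the neighbouring tile, whose centre is
   w - i^(u+1).  That centre is either in the same face of the Cube, or in the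
   one across the edge [c]; since the union of two adjacent squares is convex,
   the segment joining the two centres stays in these faces. *)
Definition opposite_side : rel side := fun x y =>
  let: (c, w, u) := x in
  let: (c', w', u') := y in
  let w1 := val w - mulI (ipow u) *+ 2 in
  [&& c' == c, val w' == w1 & u' == ordS (ordS u)]
  || [&& c' == alpha c, val w' == z *+ 2 - w1 & u' == u].

(* The reverse of [d] is the class [e] picked here; it exists and is unique when
   [k] and [l] are not both 0. *)
Definition quad_alpha (d : quad_dart) : quad_dart :=
  odflt d [pick e : quad_dart |
    [exists x, exists y, [&& quad_class x == d, quad_class y == e
                           & opposite_side x y]]].

Definition quad_prev (d : quad_dart) : quad_dart :=
  let: (c, w, u) := val d in quad_class (c, w, ord_pred u).

(* The darts leaving the origin of [d]: rotating counterclockwise, one crosses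
   the tile of [d], whose previous side ends at that origin. *)
Definition quadrangulation : cmap :=
  CMap (fun d => quad_alpha (quad_prev d)) quad_alpha.

Definition GC_octahedron : cmap := dual quadrangulation.

End GoldbergCoxeter.

(* Main.v *)
(* Let Q be the quadrangulation dual to Med(G): its tiles are the edges of G, its
   vertices are the vertices and the faces of G, of degree 4 except for the eight
   cone points of degree 3.  The rotation group H of G has order 12 and acts
   freely on the 12 darts at the trivalent vertices, hence simply transitively,
   and likewise on those of the triangles; so each cone point has a stabilizer of
   order 3, whereas no point has one of order 4.  In the quotient Q/H, all vertex
   rotations have order dividing 4, so Q/H is the quotient of the square tiling
   of the plane by a group of orientation-preserving isometries of Z[i].  As that
   group contains a rotation of order 4 about a cone point, taken as origin, its
   translations form an ideal of Z[i], principal and, as H preserves the classes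
   of vertices and faces of G, divisible by 1 + i.  With (1 + i)z a generator, the
   cone points are the multiples of z = k + li, and k + l is odd since both
   classes contain cone points.  Up to a unit and a reflection, k > l >= 0.

   A box without cone point in its interior lifts from the plane to Q.  The boxes
   circumscribed to the square 0, z, z + iz, iz and to its sides thus lift, and
   the lifts match like the faces of a cube, because the rotations about corners,
   faces and edges satisfy the presentation of the group of order 24 that acts
   simply transitively on the darts of the cube. *)
Require Import Defs.
From mathcomp Require Import all_boot all_order all_algebra all_fingroup.
From mathcomp Require Import cyclic pgroup sylow zify ring.

Set Implicit Arguments.
Unset Strict Implicit.
Unset Printing Implicit Defensive.
Import Order.TTheory GRing.Theory Num.Theory.

(** * Integer iterates and developments along a square tiling *)

Section ZIter.
Local Open Scope ring_scope.
Variables (T : Type) (f g : T -> T).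
Hypotheses (fK : cancel f g) (gK : cancel g f).

Definition ziter (n : int) (d : T) : T :=
  match n with Posz m => iter m f d | Negz m => iter m.+1 g d end.

Lemma ziterS n d : ziter (n + 1) d = f (ziter n d).
Proof.
case: n => [n|[|n]].
- by have -> : Posz n + 1 = n.+1 by lia.
- by have -> : Negz 0 + 1 = 0 by []; rewrite /= gK.
- have -> : Negz n.+1 + 1 = Negz n by lia.
  by rewrite /= gK.
Qed.

Lemma ziterB1 n d : ziter (n - 1) d = g (ziter n d).
Proof. by rewrite -{2}(subrK 1 n) ziterS fK. Qed.

Lemma ziterD m n d : ziter (m + n) d = ziter m (ziter n d).
Proof.
elim: m => [|m IH|m IH]; first by rewrite add0r.
  have -> : m.+1%:Z + n = m%:Z + n + 1 by lia.
  have -> : m.+1%:Z = m%:Z + 1 by lia.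
  by rewrite !ziterS IH.
have -> : - m.+1%:Z + n = - m%:Z + n - 1 by lia.
have -> : - m.+1%:Z = - m%:Z - 1 by lia.
by rewrite !ziterB1 IH.
Qed.

Lemma ziterK n d : ziter (- n) (ziter n d) = d.
Proof. by rewrite -ziterD addNr. Qed.

End ZIter.

Lemma ziter_morph (T U : Type) (f g : T -> T) (f' g' : U -> U) (h : T -> U) :
  (forall d, h (f d) = f' (h d)) -> (forall d, h (g d) = g' (h d)) ->
  forall n d, h (ziter f g n d) = ziter f' g' n (h d).
Proof.
move=> hf hg [n|n] d; rewrite /ziter; first by elim: n => //= n <-.
by elim: n.+1 => //= m <-.
Qed.

Lemma ziter_swap (T : Type) (f g : T -> T) n d :
  ziter f g (- n)%R d = ziter g f n d.
Proof. by case: n => [[|n]|n]. Qed.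

(* [R] and [A] act on the sides of square tiles: [R] goes to the next side of the
   same tile, counterclockwise, and [A] to the same side of the neighbouring
   tile, reversed.  With the tile drawn so that [d] is its bottom side, [stepX]
   and [stepY] move to the right and upwards keeping the direction of the side,
   and [spin] rotates about the origin of the side; [translate d x y] goes first
   horizontally, then vertically. *)
Section Ops.
Local Open Scope ring_scope.
Variables (T : Type) (R A : T -> T).
Hypotheses (R4 : forall d, R (R (R (R d))) = d) (AK : involutive A).

Definition stepX d := R (A (R d)).
Definition backX d := R (R (R (A (R (R (R d)))))).
Definition stepY d := A (R (R d)).
Definition backY d := R (R (A d)).
Definition spin d := A (R (R (R d))).
Definition translate (d : T) (x y : int) : T :=
  ziter stepY backY y (ziter stepX backX x d).

Let simpR := (R4, AK).

Lemma stepXK : cancel stepX backX.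
Proof. by move=> d; rewrite /stepX /backX !simpR. Qed.
Lemma backXK : cancel backX stepX.
Proof. by move=> d; rewrite /stepX /backX !simpR. Qed.
Lemma stepYK : cancel stepY backY.
Proof. by move=> d; rewrite /stepY /backY !simpR. Qed.
Lemma backYK : cancel backY stepY.
Proof. by move=> d; rewrite /stepY /backY !simpR. Qed.

Lemma turn_stepX d : R (stepX d) = backY (R d).
Proof. by []. Qed.
Lemma turn_backX d : R (backX d) = stepY (R d).
Proof. by rewrite /backX /stepY !simpR. Qed.
Lemma turn_stepY d : R (stepY d) = stepX (R d).
Proof. by []. Qed.
Lemma turn_backY d : R (backY d) = backX (R d).
Proof. by rewrite /backX /backY !simpR. Qed.

Lemma turn_ziterX n d :
  R (ziter stepX backX n d) = ziter stepY backY (- n) (R d).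
Proof.
rewrite ziter_swap; apply: ziter_morph => e; first exact: turn_stepX.
exact: turn_backX.
Qed.
Lemma turn_ziterY n d :
  R (ziter stepY backY n d) = ziter stepX backX n (R d).
Proof.
apply: ziter_morph => e; first exact: turn_stepY.
exact: turn_backY.
Qed.

Lemma translate0 d : translate d 0 0 = d. Proof. by []. Qed.

Lemma translateY d x y : translate d x (y + 1) = stepY (translate d x y).
Proof. by rewrite /translate ziterS //; exact: backYK. Qed.

Lemma translateYB d x y : translate d x (y - 1) = backY (translate d x y).
Proof. by rewrite /translate (ziterB1 stepYK backYK). Qed.

Lemma translate_inj x y : injective (fun d => translate d x y).
Proof.
move=> d e /(congr1 (ziter stepY backY (- y))).
rewrite /translate !(ziterK stepYK backYK).
move/(congr1 (ziter stepX backX (- x))).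
by rewrite !(ziterK stepXK backXK).
Qed.

(* A box in which all interior vertices have degree 4 is developed without
   ambiguity. *)
Lemma translateX_box (x0 x1 y0 y1 : int) d :
  x0 <= 0 -> 0 < x1 -> y0 <= 0 -> 0 < y1 ->
  (forall x y, x0 <= x -> x + 1 < x1 -> y0 <= y -> y + 1 < y1 ->
     let e := translate d x y in stepX (stepY e) = stepY (stepX e)) ->
  forall x y, x0 <= x -> x + 1 < x1 -> y0 <= y -> y < y1 ->
    translate d (x + 1) y = stepX (translate d x y).
Proof.
move=> hx0 hx1 hy0 hy1 comm x y xl xr; elim: y => [|n IH|n IH] yl yr.
- by rewrite /translate /= ziterS //; exact: backXK.
- have -> : n.+1%:Z = n%:Z + 1 by lia.
  by rewrite !translateY IH ?comm //; lia.
have En : - n.+1%:Z = - n%:Z - 1 by lia.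
apply: (can_inj stepYK).
rewrite -comm //; [|lia..].
rewrite -!translateY En subrK IH //; lia.
Qed.

(** Row 0 is reached horizontally from the origin, then each column vertically, in the order used by
    [translate]. This serves to recognise a turned development as the development from another base
    side. *)
Lemma translate_unique (x0 x1 y0 y1 : int) (F : int -> int -> T) :
  x0 <= 0 -> 0 < x1 -> y0 <= 0 -> 0 < y1 ->
  (forall x y, x0 <= x -> x + 1 < x1 -> y0 <= y -> y < y1 ->
     F (x + 1) y = stepX (F x y)) ->
  (forall x y, x0 <= x -> x < x1 -> y0 <= y -> y + 1 < y1 ->
     F x (y + 1) = stepY (F x y)) ->
  forall x y, x0 <= x -> x < x1 -> y0 <= y -> y < y1 ->
    F x y = translate (F 0 0) x y.
Proof.
move=> hx0 hx1 hy0 hy1 FX FY.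
have F0 : forall x, x0 <= x -> x < x1 -> F x 0 = ziter stepX backX x (F 0 0).
  elim=> [|n IH|n IH] xl xr //.
    have -> : n.+1%:Z = n%:Z + 1 by lia.
    by rewrite FX ?IH ?ziterS //; first [exact: backXK|lia].
  have E : - n.+1%:Z = - n%:Z - 1 by lia.
  apply: (can_inj stepXK); rewrite -FX ?E; [|lia..].
  rewrite subrK IH; [|lia..].
  by rewrite (ziterB1 stepXK backXK) backXK.
move=> x + xl xr; elim=> [|n IH|n IH] yl yr; first exact: F0.
  have -> : n.+1%:Z = n%:Z + 1 by lia.
  by rewrite FY ?IH ?translateY //; lia.
have E : - n.+1%:Z = - n%:Z - 1 by lia.
apply: (can_inj stepYK); rewrite -FY ?E; [|lia..].
rewrite subrK IH; [|lia..].
by rewrite translateYB backYK.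
Qed.

End Ops.

Lemma translate_morph (T U : Type) (R A : T -> T) (R' A' : U -> U) (h : T -> U) :
  (forall d, h (R d) = R' (h d)) -> (forall d, h (A d) = A' (h d)) ->
  forall d x y, h (translate R A d x y) = translate R' A' (h d) x y.
Proof.
move=> hR hA d x y; rewrite /translate.
rewrite (@ziter_morph _ _ _ _ (stepY R' A') (backY R' A')); first last.
- by move=> e; rewrite /backY !hR hA.
- by move=> e; rewrite /stepY hA !hR.
congr (ziter _ _ _ _); apply: ziter_morph => e.
  by rewrite /stepX !(hR, hA).
by rewrite /backX !(hR, hA).
Qed.

(** * Ideals of the Gaussian integers *)

Section GaussianIdeal.
Local Open Scope ring_scope.
Variable J : int -> int -> bool.
Hypotheses (JD : forall a b c d, J a b -> J c d -> J (a + c) (b + d))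
  (Ji : forall a b, J a b -> J (- b) a).

(** These are the coordinates of [(k + li)(s + ti)]; opposites come from [i^2 = -1], so addition and
    multiplication by [i] suffice. *)
Lemma ideal_mul (k l s t : int) : J k l -> J (k * s - l * t) (l * s + k * t).
Proof.
have JN a b : J a b -> J (- a) (- b) by move=> /Ji/Ji.
have JZ (m : int) a b : J a b -> J (a * m) (b * m).
  move=> hab; have h0 : J 0 0 by rewrite -{1}(subrr a) -(subrr b);
    apply: JD hab (JN _ _ hab).
  have hnat (n : nat) : J (a * n%:Z) (b * n%:Z).
    elim: n => [|n IH]; first by rewrite !mulr0.
    by rewrite -addn1 PoszD !mulrDr !mulr1; apply: JD.
  case: m => n //; rewrite NegzE !mulrN; apply: JN; exact: hnat.
by move=> h; have := JD (JZ s _ _ h) (JZ t _ _ (Ji h)); rewrite mulNr.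
Qed.

(** Rounding to the nearest integer keeps the remainder at most [n / 2] in absolute value, as
    Euclidean division in Z[i] requires. *)
Lemma round_div (a n : int) : 0 < n ->
  exists p r : int, a = p * n + r /\ 2 * `|r| <= n.
Proof.
move=> n0; pose q := (a %/ n)%Z; pose r := (a %% n)%Z.
have Ea : a = q * n + r by exact: divz_eq.
have r0 : 0 <= r by apply: modz_ge0; lia.
have rn : r < n by apply: ltz_pmod.
case: (lerP (2 * r) n) => h; [exists q, r | exists (q + 1), (r - n)].
  by split=> //; lia.
split; last by lia.
by rewrite Ea; ring.
Qed.

Lemma half_sqr (r n : int) : 2 * `|r| <= n -> 4 * (r * r) <= n * n.
Proof. by nia. Qed.

Lemma sum_sqr_gt0 (a b : int) : (0 < a * a + b * b) = (a != 0) || (b != 0).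
Proof. by apply/idP/idP; nia. Qed.

Lemma gaussian_ideal_principal :
  (exists a b, J a b && ((a != 0) || (b != 0))) ->
  exists k l : nat, (0 < k)%N /\ forall a b : int, J a b <->
    exists s t : int, a = k%:Z * s - l%:Z * t /\ b = l%:Z * s + k%:Z * t.
Proof.
move=> [a0 [b0 /andP[J0 nz0]]].
pose nrm (a b : int) : int := a * a + b * b.
(* An element of norm [n] has coordinates in [[-n, n]]; the bounded search makes [P] boolean, so
   that a least norm can be extracted. *)
pose P (n : nat) := (0 < n)%N && [exists i : 'I_(2 * n).+1,
  exists j : 'I_(2 * n).+1,
  J (i%:Z - n%:Z) (j%:Z - n%:Z) && (nrm (i%:Z - n%:Z) (j%:Z - n%:Z) == n%:Z)].
have PI a b : J a b -> 0 < nrm a b -> P `|nrm a b|%N.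
  move=> Jab n0; set n := `|_|%N.
  have En : n%:Z = nrm a b by rewrite /n; lia.
  have [ha1 ha2 hb1 hb2] : [/\ - n%:Z <= a, a <= n%:Z, - n%:Z <= b & b <= n%:Z].
    by rewrite En /nrm; split; nia.
  rewrite /P; apply/andP; split; first by lia.
  have hi : (absz (a + n%:Z)%R < (2 * n).+1)%N by lia.
  have hj : (absz (b + n%:Z)%R < (2 * n).+1)%N by lia.
  apply/existsP; exists (Ordinal hi); apply/existsP; exists (Ordinal hj) => /=.
  have -> : Posz (absz (a + n%:Z)%R) - n%:Z = a by lia.
  have -> : Posz (absz (b + n%:Z)%R) - n%:Z = b by lia.
  by rewrite Jab -En eqxx.
have exP : exists n, P n.
  by exists `|nrm a0 b0|%N; apply: PI => //; rewrite /nrm sum_sqr_gt0.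
have [a [b [Jab nab minab]]] : exists a b, [/\ J a b, 0 < nrm a b &
    forall c d, J c d -> 0 < nrm c d -> nrm a b <= nrm c d].
  case: (ex_minnP exP) => n /andP[n0 /existsP[i /existsP[j /andP[Jij /eqP E]]]] mn.
  exists (i%:Z - n%:Z), (j%:Z - n%:Z); split=> //; first by rewrite E; lia.
  by move=> c d Jcd cd0; have := mn _ (PI _ _ Jcd cd0); rewrite E; lia.
(* Euclidean division by the element [(a, b)] of least norm *)
have gen c d : J c d ->
    exists s t : int, c = a * s - b * t /\ d = b * s + a * t.
  move=> Jcd; pose n := nrm a b.
  have [s [r1 [E1 h1]]] := round_div (c * a + d * b) nab.
  have [t [r2 [E2 h2]]] := round_div (d * a - c * b) nab.
  exists s, t; pose u := c - (a * s - b * t); pose v := d - (b * s + a * t).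
  have Juv : J u v.
    rewrite /u /v.
    have -> : c - (a * s - b * t) = c + (a * (- s) - b * (- t)) by ring.
    have -> : d - (b * s + a * t) = d + (b * (- s) + a * (- t)) by ring.
    by apply: JD => //; apply: ideal_mul.
  have Er1 : r1 = u * a + v * b.
    by rewrite /u /v; rewrite /nrm in E1; lia.
  have Er2 : r2 = v * a - u * b by rewrite /u /v; rewrite /nrm in E2; lia.
  (* The product of [u + vi] with the conjugate of [a + bi] is [r1 + r2 i], and norms multiply. The
     bounds on [r1] and [r2] then give [nrm u v <= n / 2], which is below the least norm. *)
  have Enn : n * nrm u v = r1 * r1 + r2 * r2 by rewrite Er1 Er2 /n /nrm; ring.
  have hr1 := half_sqr h1.
  have hr2 := half_sqr h2.
  have huv : ~~ (0 < nrm u v).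
    apply/negP => uv0; have := minab _ _ Juv uv0; rewrite -/n => hm.
    have : n * n <= n * nrm u v by rewrite ler_pM2l.
    have : 0 < n * n by apply: mulr_gt0.
    by lia.
  have [u0 v0] : u = 0 /\ v = 0.
    by move: huv; rewrite /nrm sum_sqr_gt0 negb_or !negbK => /andP[/eqP -> /eqP ->].
  by move: u0 v0; rewrite /u /v; split; lia.
have JN x y : J x y -> J (- x) (- y) by move=> /Ji/Ji.
(* Multiplying the generator by a unit [e + fi] brings it to the quadrant [k > 0], [l >= 0]. *)
have norm : exists k l : nat, (0 < k)%N /\ exists e f : int,
   [/\ J k%:Z l%:Z, e * e + f * f = 1,
     k%:Z = a * e - b * f & l%:Z = b * e + a * f].
  have cases : (0 < a /\ 0 <= b) \/ (a <= 0 /\ 0 < b) \/ (a < 0 /\ b <= 0) \/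
    (0 <= a /\ b < 0).
    by move: nab; rewrite /nrm sum_sqr_gt0; lia.
  case: cases => [[h1 h2]|[[h1 h2]|[[h1 h2]|[h1 h2]]]].
  - exists `|a|%N, `|b|%N; split; first by lia.
    exists 1, 0; split; [|by []|lia|lia].
    by have [-> ->] : `|a|%N = a :> int /\ `|b|%N = b :> int by lia.
  - exists `|b|%N, `|a|%N; split; first by lia.
    exists 0, (-1); split; [|by []|lia|lia].
    have [-> ->] : `|b|%N = b :> int /\ `|a|%N = - a :> int by lia.
    by have := JN _ _ (Ji Jab); rewrite opprK.
  - exists `|a|%N, `|b|%N; split; first by lia.
    exists (-1), 0; split; [|by []|lia|lia].
    have [-> ->] : `|a|%N = - a :> int /\ `|b|%N = - b :> int by lia.
    exact: JN.
  - exists `|b|%N, `|a|%N; split; first by lia.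
    exists 0, 1; split; [|by []|lia|lia].
    have [-> ->] : `|b|%N = - b :> int /\ `|a|%N = a :> int by lia.
    exact: Ji.
have [k [l [k0 [e [f [Jkl ef ek el]]]]]] := norm.
exists k, l; split=> // c d; split; last by move=> [s [t [-> ->]]];
  apply: ideal_mul.
move/gen => [s [t [-> ->]]].
(* The quotient [s + ti] is multiplied by the inverse [e - fi] of the unit. *)
exists (s * e + t * f), (t * e - s * f); rewrite ek el; split.
  have -> : a * s - b * t = (a * s - b * t) * (e * e + f * f) by rewrite ef mulr1.
  by ring.
have -> : b * s + a * t = (b * s + a * t) * (e * e + f * f) by rewrite ef mulr1.
by ring.
Qed.

End GaussianIdeal.

(** * Quotients of the square tiling of the plane and their periods *)

Section SpinStep.
Variables (T : Type) (R A : T -> T).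
Hypotheses (R4 : forall d, R (R (R (R d))) = d) (AK : involutive A).
Notation X := (stepX R A).
Notation Y := (stepY R A).
Notation S := (spin R A).

(** The two paths to the diagonal tile differ by four turns about the vertex common to the four
    tiles; so they agree when the rotation about this vertex has order dividing 4. *)
Lemma spin4_stepXY d : S (S (S (S (X (Y d))))) = Y (X d).
Proof. by rewrite /spin /stepX /stepY !(R4, AK). Qed.

Lemma spinK : cancel S (fun d => R (A d)).
Proof. by move=> d; rewrite /spin AK R4. Qed.

Lemma spin_inj : injective S.
Proof. exact: can_inj spinK. Qed.
End SpinStep.

(* When all the rotations [spin] have order dividing 4, the sides are a quotient
   of those of the standard tiling of the plane. *)
Section FlatQuotient.
Local Open Scope ring_scope.
Variables (E : eqType) (R A : E -> E).
Hypotheses (R4 : forall e, R (R (R (R e))) = e) (AK : involutive A).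
Notation X := (stepX R A).
Notation X' := (backX R A).
Notation Y := (stepY R A).
Notation Y' := (backY R A).
Notation S := (spin R A).
Notation tr := (translate R A).
Hypothesis S4 : forall e, S (S (S (S e))) = e.

Let XK := stepXK R4 AK.
Let X'K := backXK R4 AK.
Let YK := stepYK R4 AK.
Let Y'K := backYK R4 AK.

Lemma stepXY e : X (Y e) = Y (X e).
Proof. by rewrite -(spin4_stepXY R4 AK) S4. Qed.

Lemma ziterXY m n e :
  ziter X X' m (ziter Y Y' n e) = ziter Y Y' n (ziter X X' m e).
Proof.
have XY' d : X (Y' d) = Y' (X d) by apply: (can_inj YK); rewrite -stepXY !Y'K.
have zX d : ziter X X' m (Y d) = Y (ziter X X' m d).
  apply/esym/ziter_morph => f; first by rewrite stepXY.
  by apply: (can_inj XK); rewrite stepXY !X'K.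
apply: ziter_morph => d //; apply: (can_inj YK).
by rewrite -zX !Y'K.
Qed.

Lemma translateD e x y x' y' : tr (tr e x y) x' y' = tr e (x + x') (y + y').
Proof.
rewrite /translate ziterXY -(ziterD XK X'K) -(ziterD YK Y'K).
by rewrite (addrC x) (addrC y).
Qed.

(** Putting the next side at the bottom multiplies displacements by [-i]. *)
Lemma turn_translate e x y : R (tr e x y) = tr (R e) y (- x).
Proof. by rewrite /translate turn_ziterY // turn_ziterX // ziterXY. Qed.

(* The quotient has a rotation of order 4 about the origin of [e]. *)
Definition cone e := S e = e.

Lemma coneP e : cone e <-> R e = Y' e.
Proof.
rewrite /cone /spin /backY; split=> h.
  by rewrite -[X in A X]h AK !R4.
have -> : R (R (R e)) = A e by rewrite h !R4.
by rewrite AK.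
Qed.

Lemma backY_translate e : Y' e = tr e 0 (-1). Proof. by []. Qed.

(** Multiplication by [-i] about the cone sends the unit square with lower left corner [x + iy] to
    the one with lower left corner [y - (x + 1)i], hence the shift by 1. *)
Lemma turn_cone e x y : cone e -> R (tr e x y) = tr e y (- x - 1).
Proof.
move=> /coneP h; rewrite turn_translate h backY_translate translateD.
by rewrite add0r addrC.
Qed.

Lemma translate_eq e x y x' y' :
  (tr e x y == tr e x' y') = (tr e (x - x') (y - y') == e).
Proof.
rewrite -(inj_eq (translate_inj R4 AK (x := - x') (y := - y'))) !translateD.
by rewrite !subrr.
Qed.

(** Quarter turns about 0 and about [v = x + iy] differ by the translation by [(1 - i)v], an
    associate of [(1 + i)v = (x - y) + i(x + y)]. *)
Lemma cone_translate e x y :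
  cone e -> cone (tr e x y) <-> tr e (x - y) (x + y) = e.
Proof.
move=> ce; rewrite coneP turn_cone // backY_translate translateD addr0.
split=> [/esym/eqP|h].
  rewrite translate_eq => /eqP h; rewrite -[RHS]h; congr (tr e _ _); ring.
apply/esym/eqP; rewrite translate_eq -[X in _ == X]h; apply/eqP.
by congr (tr e _ _); ring.
Qed.

Section Periods.
Variable e : E.
Hypothesis ce : cone e.

Lemma periodD a b c d : tr e a b = e -> tr e c d = e -> tr e (a + c) (b + d) = e.
Proof. by move=> h1 h2; rewrite -translateD h1. Qed.

Lemma period_turn a b : tr e a b = e -> tr e (- b) a = e.
Proof.
have rot c d : tr e c d = e -> tr e d (- c) = e.
  move=> h; have := congr1 R h; rewrite turn_cone // (coneP e).1 // => /eqP.
  by rewrite backY_translate translate_eq subr0 opprK subrK => /eqP.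
by move=> /rot/rot/rot; rewrite opprK.
Qed.

(* A period of odd norm makes the quotient have a rotation of order 4 about the
   centre of a tile. *)
Lemma period_even a b : (forall f, R f <> f) -> tr e a b = e ->
  exists x y : int, a = x - y /\ b = x + y.
Proof.
move=> nR h; have [ev|od] := boolP (~~ odd `|a + b|).
  exists ((a + b) %/ 2)%Z, ((b - a) %/ 2)%Z; lia.
(* The numbers [x] and [y] solve [a = x - y] and [b = x + y + 1], so that the period identifies the
   tile at [(x, y)] with its own quarter turn. *)
exfalso; pose x := ((a + b - 1) %/ 2)%Z; pose y := ((b - a - 1) %/ 2)%Z.
have [Ea Eb] : a = x - y /\ b = x + y + 1 by rewrite /x /y; lia.
apply: (nR (tr e x y)); rewrite turn_cone //; apply/esym/eqP.
rewrite translate_eq -[X in _ == X]h Ea Eb; apply/eqP; congr (tr e _ _); ring.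
Qed.

End Periods.

Lemma translate_iter_turn n d x y :
  exists x' y', tr (iter n R d) x y = iter n R (tr d x' y').
Proof.
elim: n x y => [|n IH] x y; first by exists x, y.
have [x' [y' E1]] := IH (- y) x; exists x', y'.
by rewrite /= -E1 turn_translate opprK.
Qed.

Lemma iter_turn4 n d : iter (4 * n) R d = d.
Proof. by elim: n => // n IH; rewrite mulnS iterD IH /= R4. Qed.

Lemma iter_turn_cone n e : cone e -> exists x y, iter n R e = tr e x y.
Proof.
move=> ce; elim: n => [|n [x [y IH]]]; first by exists 0, 0.
by exists y, (- x - 1); rewrite iterS IH turn_cone.
Qed.

Hypothesis transE : forall (P : E -> Prop) (e : E), P e ->
  (forall f, P f -> P (R f)) -> (forall f, P f -> P (A f)) -> forall f, P f.

Lemma transE_translate e f : exists n x y, f = iter n R (tr e x y).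
Proof.
apply: (@transE (fun f => exists n x y, f = iter n R (tr e x y)) e).
- by exists 0, 0, 0.
- by move=> _ [n [x [y ->]]]; exists n.+1, x, y.
move=> _ [n [x [y ->]]].
have -> d : A d = tr (R (R d)) 0 1 by rewrite /translate /= /stepY R4.
have [x' [y' ->]] := translate_iter_turn n.+2 (tr e x y) 0 1.
by exists n.+2, (x + x'), (y + y'); rewrite translateD.
Qed.

(** Every side is a translate of [e] turned [n] times. At a cone turns are translations, so [3 * n]
    further turns complete full rotations and leave only a translation. *)
Lemma cones_translate e f : cone f -> exists x y, f = tr e x y.
Proof.
move=> cf; have [n [x [y Ef]]] := transE_translate e f.
have [x' [y' E1]] := iter_turn_cone (3 * n) cf.
exists (x - x'), (y - y').
apply/esym/eqP; rewrite -(inj_eq (translate_inj R4 AK (x := x') (y := y'))).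
by rewrite translateD !subrK -E1 Ef -iterD -mulSnr iter_turn4.
Qed.

(** The [v] such that [(1 + i)v] is a period, which are the positions of the cones relative to [e],
    form an ideal with generator [z = k + li]. Since periods are divisible by [1 + i], they are the
    [(1 + i)z(p + qi)]. *)
Lemma cone_period_lattice (col : E -> bool) :
  (forall e, exists2 n, (0 < n)%N & iter n X e = e) ->
  (forall e, col (R e) = ~~ col e) -> (forall e, col (A e) = ~~ col e) ->
  (forall b, exists2 e, cone e & col e = b) ->
  exists k l : nat, [/\ (0 < k)%N, odd (k + l) &
    forall e a b, cone e -> tr e a b = e <-> exists p q : int,
      a = k%:Z * (p - q) - l%:Z * (p + q) /\
      b = l%:Z * (p - q) + k%:Z * (p + q)].
Proof.
move=> finX colR colA cones.
have [e ce _] := cones true.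
have nR f : R f <> f by move/(congr1 col); rewrite colR; case: (col f).
pose J a b := tr e (a - b) (a + b) == e.
have [k [l [k0 Jkl]]] : exists k l : nat, (0 < k)%N /\ forall a b : int, J a b <->
    exists s t : int, a = k%:Z * s - l%:Z * t /\ b = l%:Z * s + k%:Z * t.
  apply: gaussian_ideal_principal.
  - move=> a b c d /eqP h1 /eqP h2; apply/eqP.
    by rewrite -[RHS](periodD h1 h2); congr (tr e _ _); ring.
  - move=> a b /eqP h; apply/eqP; rewrite -[RHS](period_turn ce h).
    by congr (tr e _ _); ring.
  (* The ideal is nonzero: [(1 + i)(n + ni) = 2ni] is twice the quarter turn of the period [n]. *)
  have [n n0 En] := finX e; exists n%:Z, n%:Z.
  rewrite /J subrr; apply/andP; split; last by lia.
  have h : tr e n%:Z 0 = e by [].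
  apply/eqP; have := periodD (period_turn ce h) (period_turn ce h).
  by rewrite oppr0 addr0.
have per a b : tr e a b = e <-> exists p q : int,
      a = k%:Z * (p - q) - l%:Z * (p + q) /\
      b = l%:Z * (p - q) + k%:Z * (p + q).
  split=> [h|[p [q [-> ->]]]].
    have [x [y [Ea Eb]]] := period_even ce nR h.
    have /Jkl [s [t [Ex Ey]]] : J x y by rewrite /J -Ea -Eb h.
    by exists s, t; rewrite Ea Eb Ex Ey; split; ring.
  have : J (k%:Z * p - l%:Z * q) (l%:Z * p + k%:Z * q) by apply/Jkl; exists p, q.
  by move/eqP => h; rewrite -[RHS]h; congr (tr e _ _); ring.
exists k, l; split=> //; last first.
  (* All cones are translates of [e] and translations commute, so the periods are the same at every
     cone. *)
  move=> f a b cf; rewrite -per; have [x [y ->]] := cones_translate e cf.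
  split=> [/eqP|h]; last first.
    by rewrite translateD addrC (addrC y) -translateD h.
  by rewrite translateD translate_eq ![_ + _ - _]addrAC !subrr !add0r => /eqP.
have coltr x y : col (tr e x y) = col e (+) odd `|x + y|.
  have colit (f g : E -> E) n d : (forall d, col (f d) = ~~ col d) ->
      (forall d, col (g d) = ~~ col d) -> col (ziter f g n d) = col d (+) odd `|n|.
    move=> hf hg; case: n => n; rewrite /ziter.
      elim: n => [|n IH]; first by rewrite addbF.
      by rewrite iterS hf IH /=; case: (col d); case: (odd n).
    rewrite -[in RHS](_ : n.+1 = `|Negz n|%N) //.
    elim: n.+1 => [|m IH]; first by rewrite addbF.
    by rewrite iterS hg IH /=; case: (col d); case: (odd m).
  rewrite /translate !colit; last 4 first.
  - by move=> d; rewrite /stepX !(colR, colA); case: (col d).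
  - by move=> d; rewrite /backX !(colR, colA); case: (col d).
  - by move=> d; rewrite /stepY !(colR, colA); case: (col d).
  - by move=> d; rewrite /backY !(colR, colA); case: (col d).
  rewrite -addbA; congr (_ (+) _); lia.
(* Each unit step changes the colour, so a cone of the other colour lies at some [x + iy] in the
   ideal with [x + y] odd. If [k] and [l] had the same parity, [x + y] would be even. *)
have [f cf colf] := cones (~~ col e).
have [x [y Ef]] := cones_translate e cf.
move: colf; rewrite Ef coltr => hodd.
have {}hodd : odd `|x + y| by move: hodd; case: (col e); case: (odd _).
have /Jkl [s [t [Ex Ey]]] : J x y.
  by apply/eqP/(cone_translate _ _ ce); rewrite -Ef.
move: hodd; rewrite Ex Ey; clear; rewrite oddD.
rewrite -(odd_double_half k) -(odd_double_half l) !oddD !odd_double.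
case: (odd k); case: (odd l) => //; move: k./2 l./2 => k' l' /=.
  have -> : (1 + k'.*2)%N%:Z * s - (1 + l'.*2)%N%:Z * t +
    ((1 + l'.*2)%N%:Z * s + (1 + k'.*2)%N%:Z * t) =
    2 * (s + k'%:Z * (s + t) + l'%:Z * (s - t)) by rewrite !PoszD -!muln2
      !PoszM; ring.
  lia.
have -> : (0 + k'.*2)%N%:Z * s - (0 + l'.*2)%N%:Z * t +
    ((0 + l'.*2)%N%:Z * s + (0 + k'.*2)%N%:Z * t) =
    2 * (k'%:Z * (s + t) + l'%:Z * (s - t)) by rewrite !PoszD -!muln2 !PoszM; ring.
lia.
Qed.
End FlatQuotient.

(** * The cube *)

Section CubeOps.

Lemma odd_card_flip (v : {set 'I_3}) j : odd #|flip v j| = ~~ odd #|v|.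
Proof.
rewrite /flip; case: ifP => [jv|/negbT jv]; last by rewrite cardsU1 jv.
by rewrite (cardsD1 j v) jv negbK.
Qed.

Lemma in_flip (v : {set 'I_3}) i j : (i \in flip v j) = (i \in v) (+) (i == j).
Proof.
rewrite /flip; case: ifP => jv; rewrite !inE; case: eqP => [->|_] //=.
  by rewrite jv.
  by rewrite addbF.
  by rewrite jv.
by rewrite addbF.
Qed.

Lemma flipK j : involutive (flip^~ j).
Proof. by move=> v; apply/setP=> i; rewrite !in_flip -addbA addbb addbF. Qed.

Lemma cube_sigma3 c : cube_sigma (cube_sigma (cube_sigma c)) = c.
Proof.
case: c => v j; rewrite /cube_sigma; congr pair.
by case: (odd #|v|); apply/val_inj; case: j => [[|[|[|j]]]].
Qed.

Lemma cube_sigma_inj : injective (@sigma cube).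
Proof. exact: (can_inj (g := fun c => cube_sigma (cube_sigma c)) cube_sigma3). Qed.

Lemma cube_alphaK : involutive (@alpha cube).
Proof. by case=> v j; rewrite /= flipK. Qed.

Lemma cube_sigma_phi (c : cube) : sigma (phi c) = alpha c.
Proof. exact: f_finv cube_sigma_inj _. Qed.

Lemma cube_phiE (c : cube) : phi c = cube_sigma (cube_sigma (cube_alpha c)).
Proof. by apply: cube_sigma_inj; rewrite cube_sigma_phi /= cube_sigma3. Qed.

Lemma cube_phi_inj : injective (@phi cube).
Proof.
move=> c c' /(congr1 sigma); rewrite !cube_sigma_phi; exact: (inv_inj cube_alphaK).
Qed.

Lemma card_cube : #|cube| = 24.
Proof. by rewrite card_prod -cardsT -powersetT card_powerset cardsT card_ord. Qed.

End CubeOps.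

(* Darts of the cube as words in [sigma] and [phi] applied to a base dart [c]:
   [phi^j c], [phi^j sigma phi^i c] and [phi^j sigma phi^-1 sigma c]. *)
Inductive cube_word := Face0 of nat | Side of nat & nat | Face1 of nat.

(** The base dart, with code [Face0 0], leaves [set0] along axis 0. The table is validated by
    [cube_code_sigma] and [cube_code_phi]. *)
Definition cube_code (c : cube) : cube_word :=
  let: (v, j) := c in
  match inord 0 \in v, inord 1 \in v, inord 2 \in v, val j with
  | false, false, false, 0 => Face0 0
  | false, false, false, 1 => Side 1 1
  | false, false, false, _ => Side 0 0
  | false, false, true, 0 => Side 0 3
  | false, false, true, 1 => Side 1 0
  | false, false, true, _ => Face0 3
  | false, true, false, 0 => Side 2 1
  | false, true, false, 1 => Side 3 0
  | false, true, false, _ => Face1 0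
  | false, true, true, 0 => Face1 1
  | false, true, true, 1 => Side 3 3
  | false, true, true, _ => Side 2 0
  | true, false, false, 0 => Side 0 1
  | true, false, false, 1 => Side 1 2
  | true, false, false, _ => Face0 1
  | true, false, true, 0 => Face0 2
  | true, false, true, 1 => Side 1 3
  | true, false, true, _ => Side 0 2
  | true, true, false, 0 => Face1 3
  | true, true, false, 1 => Side 3 1
  | true, true, false, _ => Side 2 2
  | true, true, true, 0 => Side 2 3
  | true, true, true, 1 => Side 3 2
  | true, true, true, _ => Face1 2
  end.

Section CubePresentation.
Variables (T : Type) (s p : T -> T) (C : T -> Prop) (d0 : T).
Hypotheses (Cs : forall d, C d -> C (s d)) (Cp : forall d, C d -> C (p d)).
Hypotheses (s3 : forall d, C d -> s (s (s d)) = d)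
  (p4 : forall d, C d -> p (p (p (p d))) = d)
  (sp2 : forall d, C d -> s (p (s (p d))) = d) (C0 : C d0).

Definition word_eval (w : cube_word) : T :=
  match w with
  | Face0 j => iter j p d0
  | Side j i => iter j p (s (iter i p d0))
  | Face1 j => iter j p (s (p (p (p (s d0)))))
  end.

Lemma word_eval_ind (Q : T -> Prop) : Q d0 ->
  (forall d, C d -> Q d -> Q (s d)) -> (forall d, C d -> Q d -> Q (p d)) ->
  forall w, Q (word_eval w).
Proof.
move=> Q0 Qs Qp w; suff [] : Q (word_eval w) /\ C (word_eval w) by [].
have it n d : Q d /\ C d -> Q (iter n p d) /\ C (iter n p d).
  by elim: n => //= n IH /IH[h1 h2]; split; auto.
have st d : Q d /\ C d -> Q (s d) /\ C (s d) by move=> [h1 h2]; split; auto.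
case: w => [j|j i|j]; apply/it => //; apply/st; first exact/it.
exact/(it 3)/st.
Qed.

(** This rule and the next four follow from the three relations; they bring [s] applied to a word
    back to a word, as tabulated in [word_sigma]. *)
Let pp_s d : C d -> p (s (p d)) = s (s d).
Proof. by move=> Cd; rewrite -[in RHS](sp2 Cd) s3 //; auto. Qed.

Let sps d : C d -> s (p (s d)) = p (p (p d)).
Proof. by move=> Cd; rewrite -{1}(p4 Cd) sp2 //; auto 6. Qed.

Let sp d : C d -> s (p d) = p (p (p (s (s d)))).
Proof. by move=> Cd; rewrite -pp_s // p4; auto. Qed.

Let spps d : C d -> s (p (p (s d))) = p (p (p (s (p (p (p d)))))).
Proof. by move=> Cd; rewrite sp ?sps; auto. Qed.

Let spppsp d : C d -> s (p (p (p (s (p d))))) = p (p (p (s (p (p (p (s d))))))).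
Proof. by move=> Cd; rewrite (sp Cd) p4 ?spps; auto 10. Qed.

Definition word_sigma (w : cube_word) : cube_word :=
  match w with
  | Face0 j => Side 0 j
  | Side 0 i => Side 1 ((i + 1) %% 4)
  | Side 1 i => Face0 ((i + 3) %% 4)
  | Side 2 i => Side 3 ((i + 3) %% 4)
  | Side _ i => Face1 ((3 * i) %% 4)
  | Face1 0 => Side 2 1
  | Face1 1 => Side 2 0
  | Face1 2 => Side 2 3
  | Face1 _ => Side 2 2
  end.

Definition word_phi (w : cube_word) : cube_word :=
  match w with
  | Face0 j => Face0 (j.+1 %% 4)
  | Side j i => Side (j.+1 %% 4) i
  | Face1 j => Face1 (j.+1 %% 4)
  end.

Definition small_word (w : cube_word) : bool :=
  match w with
  | Face0 j => j < 4 | Side j i => (j < 4) && (i < 4) | Face1 j => j < 4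
  end.

Lemma word_eval_phi w : small_word w -> word_eval (word_phi w) = p (word_eval w).
Proof.
have it j d : j < 4 -> C d -> iter (j.+1 %% 4) p d = p (iter j p d).
  by case: j => [|[|[|[|j]]]] // _ Cd; rewrite /= p4.
have Cit n d : C d -> C (iter n p d) by elim: n => //= n IH /IH; auto.
case: w => [j h|j i /andP[h _]|j h] /=; rewrite it //; last by auto 6.
by apply/Cs/Cit.
Qed.

Lemma word_eval_sigma w : small_word w ->
  word_eval (word_sigma w) = s (word_eval w).
Proof.
case: w => [j|j i|j] //=.
  move=> /andP[hj hi]; move: hj.
  have Ci : C (iter i p d0) by elim: i {hi} => //=; auto.
  case: j => [|[|[|[|j]]]] // _.
  - rewrite /= -pp_s //; congr (p (s _)).
    by case: i hi Ci => [|[|[|[|i]]]] //= _ _; rewrite p4.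
  - by rewrite sps //; case: i hi Ci => [|[|[|[|i]]]] //= _ _; rewrite !p4; auto.
  - rewrite spps //=; congr (p (p (p (s _)))).
    by case: i hi Ci => [|[|[|[|i]]]] //= _ _; rewrite !p4; auto.
  - case: i hi Ci => [|[|[|[|i]]]] //= _ _.
    + by rewrite spppsp.
    + by rewrite !spppsp ?p4; auto 10.
    + by rewrite !spppsp ?p4; auto 10.
case: j => [|[|[|[|j]]]] // _ /=.
- by rewrite -pp_s ?p4 -?pp_s; auto 10.
- by rewrite sps ?p4; auto 10.
- by rewrite spps ?p4 ?spps ?p4; auto 10.
- by rewrite spppsp ?spps ?p4 ?spps ?p4; auto 10.
Qed.

Lemma cube_code_small c : small_word (cube_code c).
Proof.
case: c => v j; rewrite /cube_code; case: (_ \in _); case: (_ \in _);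
  case: (_ \in _); by case: (val j) => [|[|n]].
Qed.

Lemma odd_card_bits (v : {set 'I_3}) :
  odd #|v| = (inord 0 \in v) (+) (inord 1 \in v) (+) (inord 2 \in v).
Proof.
rewrite -sum1_card big_mkcond !big_ord_recl big_ord0 /=.
have -> : (inord 0 : 'I_3) = ord0 by apply/val_inj; rewrite /= inordK.
have -> : (inord 1 : 'I_3) = lift ord0 ord0 by apply/val_inj; rewrite /= inordK.
have -> : (inord 2 : 'I_3) = lift ord0 (lift ord0 ord0).
  by apply/val_inj; rewrite /= inordK.
by case: (_ \in _); case: (_ \in _); case: (_ \in _).
Qed.

Lemma cube_code_sigma c : cube_code (cube_sigma c) = word_sigma (cube_code c).
Proof.
case: c => v j; rewrite /cube_sigma odd_card_bits /cube_code.
case: (_ \in _); case: (_ \in _); case: (_ \in _);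
  by case: j => [[|[|[|j]]] lj].
Qed.

Lemma cube_code_phi c : cube_code (@phi cube c) = word_phi (cube_code c).
Proof.
case: c => v j; rewrite cube_phiE /cube_sigma /cube_alpha !odd_card_flip.
rewrite odd_card_bits /cube_code !in_flip.
have E (i : nat) : i < 3 -> (inord i == j) = (i == val j).
  by move=> hi; rewrite -val_eqE /= inordK.
rewrite !E //.
case: (_ \in _); case: (_ \in _); case: (_ \in _);
  by case: j {E} => [[|[|[|j]]] lj].
Qed.

(** The relations [s^3 = p^4 = (sp)^2 = 1] present the rotation group of the cube, simply transitive
    on the 24 darts. They are assumed on [C] only, which will be the set of sides issued from cone
    points. *)
Lemma cube_presentation : exists psi : cube -> T,
  [/\ forall c, psi (sigma c) = s (psi c), forall c, psi (phi c) = p (psi c)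
    & forall Q : T -> Prop, Q d0 -> (forall d, C d -> Q d -> Q (s d)) ->
        (forall d, C d -> Q d -> Q (p d)) -> forall c, Q (psi c)].
Proof.
exists (fun c => word_eval (cube_code c)); split=> [c|c|Q Q0 Qs Qp c].
- by rewrite -word_eval_sigma ?cube_code_small // -cube_code_sigma.
- by rewrite -word_eval_phi ?cube_code_small // -cube_code_phi.
exact: word_eval_ind.
Qed.

End CubePresentation.

(** * Charts of the faces of the cube *)

Section Neighbours.
Local Open Scope ring_scope.

Definition neighbour (w : gauss) (u : 'I_4) : gauss := w - mulI (ipow u) *+ 2.

Lemma neighbourE a b (u : 'I_4) : neighbour (a, b) u =
  match val u with
  | 0 => (a, b - 2) | 1 => (a + 2, b) | 2 => (a, b + 2) | _ => (a - 2, b)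
  end.
Proof.
rewrite /neighbour /ipow.
by case: u => [[|[|[|[|u]]]] hu] //; congr pair; rewrite /=; lia.
Qed.

Lemma odd_neighbour (w : gauss) u : odd `|w.1|%N -> odd `|w.2|%N ->
  odd `|(neighbour w u).1|%N && odd `|(neighbour w u).2|%N.
Proof.
case: w => a b; rewrite neighbourE /= => oa ob.
by case: u => [[|[|[|[|u]]]] hu] //=; lia.
Qed.

Lemma neighbour_cases (w : gauss) u : let w1 := neighbour w u in
  (w1.1 = w.1 /\ (w1.2 = w.2 - 2 \/ w1.2 = w.2 + 2)) \/
  (w1.2 = w.2 /\ (w1.1 = w.1 - 2 \/ w1.1 = w.1 + 2)).
Proof.
case: w => a b w1; rewrite /w1 neighbourE.
by case: u {w1} => [[|[|[|[|u]]]] hu] //=; auto.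
Qed.

End Neighbours.

Section GCCharts.
Local Open Scope ring_scope.
Variables k l : nat.
Notation n := (2 * (k%:Z * k%:Z + l%:Z * l%:Z)).

Lemma alongE (w : gauss) : along k l w = k%:Z * w.1 + l%:Z * w.2.
Proof. by []. Qed.

Lemma acrossE (w : gauss) : across k l w = k%:Z * w.2 - l%:Z * w.1.
Proof. by []. Qed.

Lemma in_squareE w : in_square k l w =
  [&& 0 <= along k l w, along k l w <= n, 0 <= across k l w & across k l w <= n].
Proof.
rewrite /in_square; have -> // : (k ^ 2 + l ^ 2)%N%:Z *+ 2 = n.
by rewrite !expnS !expn0; lia.
Qed.

Lemma z2_subE (v : gauss) : z k l *+ 2 - v = (2 * k%:Z - v.1, 2 * l%:Z - v.2).
Proof. by case: v => a b; rewrite /z; congr pair; rewrite /=; lia. Qed.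

(* The change of coordinates to the next chart of the same face. *)
Definition turn_centre (w : gauss) : gauss := (w.2 - 2 * l%:Z, 2 * k%:Z - w.1).

Lemma turn_centreE (w : gauss) : - mulI (w - z k l *+ 2) = turn_centre w.
Proof.
by case: w => a b; rewrite /mulI /turn_centre /z; congr pair; rewrite /=; lia.
Qed.

Lemma along_turn w : along k l (turn_centre w) = across k l w.
Proof. by rewrite alongE acrossE /=; ring. Qed.

Lemma across_turn w : across k l (turn_centre w) = n - along k l w.
Proof. by rewrite alongE acrossE /=; ring. Qed.

Lemma neighbour_turn w (u : 'I_4) :
  neighbour (turn_centre w) (ord_pred u) = turn_centre (neighbour w u).
Proof.
case: w => a b; rewrite !neighbourE /turn_centre /=.
by case: u => [[|[|[|[|u]]]] hu] //=; congr pair; lia.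
Qed.

Hypothesis ltlk : (l < k)%N.

(** Here [along + i across] is the product of [w] and the conjugate of [z]. Multiplying it by [z]
    gives [N w], whence the bounding box of the slanted square. *)
Lemma square_coord a b :
  [&& 0 <= k%:Z * a + l%:Z * b, k%:Z * a + l%:Z * b <= n,
      0 <= k%:Z * b - l%:Z * a & k%:Z * b - l%:Z * a <= n] ->
  [/\ - (2 * l%:Z) <= a, a <= 2 * k%:Z, 0 <= b & b <= 2 * (k%:Z + l%:Z)].
Proof.
move=> /and4P[h1 h2 h3 h4]; set N := k%:Z * k%:Z + l%:Z * l%:Z in h2 h4.
have N0 : 0 < N by rewrite /N; nia.
have Ea : N * a = k%:Z * (k%:Z * a + l%:Z * b) - l%:Z * (k%:Z * b - l%:Z * a)
  by rewrite /N; ring.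
have Eb : N * b = l%:Z * (k%:Z * a + l%:Z * b) + k%:Z * (k%:Z * b - l%:Z * a)
  by rewrite /N; ring.
move: h1 h2 h3 h4 Ea Eb; set u := _ + l%:Z * b; set v := _ - l%:Z * a.
move: u v => u v h1 h2 h3 h4 Ea Eb.
have cancelN x y : N * x <= N * y -> x <= y by rewrite ler_pM2l.
have ku : 0 <= k%:Z * u <= k%:Z * (2 * N) by rewrite mulr_ge0 // ler_wpM2l.
have kv : 0 <= k%:Z * v <= k%:Z * (2 * N) by rewrite mulr_ge0 // ler_wpM2l.
have lu : 0 <= l%:Z * u <= l%:Z * (2 * N) by rewrite mulr_ge0 // ler_wpM2l.
have lv : 0 <= l%:Z * v <= l%:Z * (2 * N) by rewrite mulr_ge0 // ler_wpM2l.
split; apply: cancelN; rewrite ?Ea ?Eb; clear Ea Eb; clearbody N.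
all: lia.
Qed.

Lemma mem_centres w : (w \in centres k l) =
  [&& odd `|w.1|%N, odd `|w.2|%N & in_square k l w].
Proof.
rewrite mem_filter; apply: andb_idr => /and3P[_ _].
case: w => a b; rewrite in_squareE => hsq.
have {hsq} [h1 h2 h3 h4] : [/\ - (2 * l%:Z) <= a, a <= 2 * k%:Z,
  0 <= b & b <= 2 * (k%:Z + l%:Z)].
  exact: square_coord hsq.
have memr (x : int) : - (2 * (k%:Z + l%:Z)) <= x -> x <= 2 * (k%:Z + l%:Z) ->
    x \in [seq i%:Z - (2 * (k + l))%N%:Z | i <- iota 0 (2 * (2 * (k + l))).+1].
  move=> x1 x2; apply/mapP; exists (absz (x + 2 * (k%:Z + l%:Z))%R).
    by rewrite mem_iota; lia.
  by lia.
by apply: allpairs_f; [apply: (memr a) | apply: (memr b)]; lia.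
Qed.

Lemma mem_turn_centre w : w \in centres k l -> turn_centre w \in centres k l.
Proof.
rewrite !mem_centres !in_squareE along_turn across_turn /=.
by move=> /and3P[o1 o2 /and4P[h1 h2 h3 h4]]; apply/and3P; split; [lia..|];
  apply/and4P; split; lia.
Qed.

Hypothesis odd_kl : odd (k + l).

(** With [k + l] odd, centres have odd [along] and [across], whereas the border of the square lies
    at the even values 0 and [n]. So no centre is on the border. *)
Lemma odd_along (w : gauss) : odd `|w.1|%N -> odd `|w.2|%N ->
  odd `|along k l w|%N /\ odd `|across k l w|%N.
Proof.
case: w => a b /= oa ob; rewrite alongE acrossE /=.
have [a' Ea] : exists a', a = 2 * a' + 1 by exists ((a - 1) %/ 2)%Z; lia.
have [b' Eb] : exists b', b = 2 * b' + 1 by exists ((b - 1) %/ 2)%Z; lia.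
rewrite Ea Eb; split.
  have -> : k%:Z * (2 * a' + 1) + l%:Z * (2 * b' + 1) =
    2 * (k%:Z * a' + l%:Z * b') + (k + l)%N%:Z by rewrite PoszD; ring.
  lia.
have -> : k%:Z * (2 * b' + 1) - l%:Z * (2 * a' + 1) =
    2 * (k%:Z * b' - l%:Z * a' - l%:Z) + (k + l)%N%:Z by rewrite PoszD; ring.
lia.
Qed.

Lemma centreP (w : gauss) : w \in centres k l ->
  [/\ odd `|w.1|%N, odd `|w.2|%N, 0 < along k l w < n & 0 < across k l w < n].
Proof.
rewrite mem_centres in_squareE => /and3P[o1 o2 /and4P[h1 h2 h3 h4]].
by have [o3 o4] := odd_along o1 o2; split=> //; lia.
Qed.

Lemma centre_one : (1, 1) \in centres k l.
Proof.
by rewrite mem_centres in_squareE alongE acrossE !mulr1; apply/and3P;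
  split=> //; apply/and4P; split; nia.
Qed.

(** A tile leaving the square through the edge from 0 to [z] must not pass beyond its ends: [along]
    has to stay within [[0, n]]. Parity excludes the bad positions near 0 and near [z]. *)
Lemma neighbour_across w u : w \in centres k l -> across k l (neighbour w u) < 0 ->
  z k l *+ 2 - neighbour w u \in centres k l.
Proof.
case: w => a b; set N := k%:Z * k%:Z + l%:Z * l%:Z.
have N0 : 0 < N by rewrite /N; nia.
have cancelN x y : N * x < N * y -> x < y by rewrite ltr_pM2l.
have kN : k%:Z <= N by rewrite /N; nia.
(* An odd multiple of [k] has absolute value at least [k], which exceeds [l]. *)
have mulk (x : int) : odd `|x| -> ~ (- l%:Z < k%:Z * x /\ k%:Z * x < l%:Z).
  move=> ox [x1 x2]; have [h|h] : 1 <= x \/ x <= -1 by lia.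
    by have := ler_wpM2l (isT : 0 <= k%:Z) h; lia.
  by have := ler_wpM2l (isT : 0 <= k%:Z) h; lia.
move=> /centreP[] /=;
  rewrite !alongE !acrossE /= => oa ob /andP[p1 p2] /andP[q1 q2] hlt.
have /andP[on1 on2] := odd_neighbour u (w := (a, b)) oa ob.
rewrite z2_subE mem_centres in_squareE alongE acrossE.
move: hlt on1 on2; rewrite neighbourE;
  case: u => [[|[|[|[|u]]]] hu] //= hlt on1 on2.
(* Otherwise the centre is so close to 0 that [b = 1], and [mulk] is contradicted at [a]. *)
- have h : 2 * l%:Z < k%:Z * a + l%:Z * b.
    rewrite ltNge; apply/negP => h.
    have Eb : N * b = l%:Z * (k%:Z * a + l%:Z * b) + k%:Z * (k%:Z * b - l%:Z *
      a) by rewrite /N; ring.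
    have b0 : 0 < b.
      apply: cancelN; rewrite Eb mulr0; apply: ltr_wpDl.
        by apply: mulr_ge0 => //; lia.
      by apply: mulr_gt0 => //; lia.
    have b2 : b < 2.
      apply: cancelN; rewrite Eb;
        have -> : N * 2 = l%:Z * (2 * l%:Z) + k%:Z * (2 * k%:Z) by rewrite /N; ring.
      apply: ler_ltD; first by apply: ler_wpM2l.
      by rewrite ltr_pM2l //; lia.
    have b1 : b = 1 by lia.
    by subst b; apply: (mulk a oa); split; lia.
  by apply/and3P; split; [lia..|]; apply/and4P; split; lia.
(* Otherwise the centre is close to the far end [2z]; measured from there it has first coordinate
   [u1 = -1], and [mulk] is contradicted at [v1]. *)
- have h : k%:Z * a + l%:Z * b + 2 * k%:Z < 2 * N.
    rewrite ltNge; apply/negP => h.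
    set u1 := a - 2 * k%:Z; set v1 := b - 2 * l%:Z.
    have E1 : k%:Z * u1 + l%:Z * v1 = k%:Z * a + l%:Z * b - 2 * N by rewrite
      /u1 /v1 /N; ring.
    have E2 : k%:Z * v1 - l%:Z * u1 = k%:Z * b - l%:Z * a by rewrite /u1 /v1; ring.
    have Eu : N * u1 = k%:Z * (k%:Z * u1 + l%:Z * v1) - l%:Z * (k%:Z * v1 -
      l%:Z * u1) by rewrite /N; ring.
    have ub : u1 < 0.
      apply: cancelN; rewrite Eu mulr0 subr_lt0; apply: (@lt_le_trans _ _ 0);
        last by apply: mulr_ge0; lia.
      by rewrite pmulr_rlt0; lia.
    have ua : -2 <= u1.
      suff : -3 < u1 by lia.
      apply: cancelN; rewrite Eu;
        have -> : N * -3 = k%:Z * (- 2 * k%:Z) - l%:Z * (2 * l%:Z) - N by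
          rewrite /N; ring.
      have g1 : k%:Z * (- 2 * k%:Z) <= k%:Z * (k%:Z * u1 + l%:Z * v1) by apply:
        ler_wpM2l => //; lia.
      have g2 : l%:Z * (k%:Z * v1 - l%:Z * u1) <= l%:Z * (2 * l%:Z) by apply:
        ler_wpM2l => //; lia.
      by lia.
    have u1E : u1 = -1 by rewrite /u1 in ua ub *; lia.
    by rewrite u1E in E1 E2; apply: (mulk v1); rewrite ?/v1; lia.
  by apply/and3P; split; [lia..|]; apply/and4P; split; lia.
(* Moves upwards or to the left do not decrease [across]. *)
- by exfalso; lia.
- by exfalso; lia.
Qed.

End GCCharts.

(** * Development of a tiling with tetrahedral symmetry *)

(* [E] is the quotient of [D] by the group of rotations.  By [period], the tiles
   of [E] are those of the plane modulo the rotations by multiples of 90 degrees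
   about the multiples of z = k + li. *)
Section Development.
Local Open Scope ring_scope.
Variables (D : finType) (E : eqType) (R A : D -> D) (RE AE : E -> E) (pr : D -> E).
Variables k l : nat.
Hypotheses (R4 : forall d, R (R (R (R d))) = d) (AK : involutive A).
Hypotheses (R4E : forall e, RE (RE (RE (RE e))) = e) (AKE : involutive AE).
Hypothesis S4E : forall e,
  spin RE AE (spin RE AE (spin RE AE (spin RE AE e))) = e.
Hypotheses (prR : forall d, pr (R d) = RE (pr d)) (prA : forall d,
  pr (A d) = AE (pr d)).
Notation X := (stepX R A).
Notation Y := (stepY R A).
Notation S := (spin R A).
Notation tr := (translate R A).
Notation trE := (translate RE AE).
Notation coneE := (cone RE AE).
Hypothesis regular : forall d, S (S (S (S d))) = d \/ coneE (pr d).
Hypothesis cone3 : forall d, coneE (pr d) -> S (S (S d)) = d.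
Hypothesis period : forall e a b, coneE e -> trE e a b = e <->
  exists p q : int, a = k%:Z * (p - q) - l%:Z * (p + q) /\
                    b = l%:Z * (p - q) + k%:Z * (p + q).
Hypothesis ltlk : (l < k)%N.

Let pr_tr d x y : pr (tr d x y) = trE (pr d) x y.
Proof. exact: translate_morph. Qed.

Definition lattice (x y : int) := exists p q : int,
  x = k%:Z * p - l%:Z * q /\ y = l%:Z * p + k%:Z * q.

Lemma cone_lattice e x y : coneE e -> coneE (trE e x y) <-> lattice x y.
Proof.
move=> ce; rewrite cone_translate // period //.
split=> -[p [q [E1 E2]]]; exists p, q; last by rewrite E1 E2; split; ring.
by split; lia.
Qed.

(** The vertex at the upper right corner of the tile is not a cone, so [regular] makes four spins
    about it trivial. *)
Lemma stepXY_regular d x y : coneE (pr d) -> ~ lattice (x + 1) (y + 1) ->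
  let e := tr d x y in X (Y e) = Y (X e).
Proof.
move=> cd nl e; rewrite -(spin4_stepXY R4 AK).
case: (regular (X (Y e))) => [-> //|]; rewrite /e.
have -> : pr (X (Y (tr d x y))) = trE (pr d) (x + 1) (y + 1).
  rewrite -(translateD R4E AKE S4E) -pr_tr [RHS]/translate /=.
  by rewrite -(stepXY R4E AKE S4E) /stepX /stepY !(prR, prA).
by move/cone_lattice => /(_ cd) /nl.
Qed.

Let N := k%:Z * k%:Z + l%:Z * l%:Z.
Let N0 : 0 < N.
Proof. by rewrite /N; nia. Qed.

Let mulN_bound (s b : int) : s * N < b * N -> s < b.
Proof. by rewrite ltr_pM2r. Qed.

(** In the basis [z], [iz] such a point would have both coordinates in {0, 1}; it would be a corner
    of the inscribed square, and these lie on the border of the box. *)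
Lemma lattice_face_box x y :
  - l%:Z < x -> x < k%:Z -> 0 < y -> y < k%:Z + l%:Z -> ~ lattice x y.
Proof.
move=> x1 x2 y1 y2 [p [q [Ex Ey]]].
have Ep : p * N = k%:Z * x + l%:Z * y by rewrite Ex Ey /N; ring.
have Eq : q * N = k%:Z * y - l%:Z * x by rewrite Ex Ey /N; ring.
have kl : l%:Z * k%:Z <= k%:Z * k%:Z by nia.
have p1 : p < 2 by apply: mulN_bound; rewrite Ep /N; nia.
have p0 : -1 < p by apply: mulN_bound; rewrite Ep /N; nia.
have q1 : q < 2 by apply: mulN_bound; rewrite Eq /N; nia.
have q0 : -1 < q by apply: mulN_bound; rewrite Eq /N; nia.
have [Ep0|Ep1] : p = 0 \/ p = 1 by lia.
  by have [Eq0|Eq1] : q = 0 \/ q = 1 by [lia|]; subst; lia.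
by have [Eq0|Eq1] : q = 0 \/ q = 1 by [lia|]; subst; lia.
Qed.

(** The first coordinate in the basis [z], [iz] would lie strictly between 0 and 1. *)
Lemma lattice_edge_box x y :
  0 < x -> x < k%:Z -> 0 <= y -> y <= l%:Z -> ~ lattice x y.
Proof.
move=> x1 x2 y1 y2 [p [q [Ex Ey]]].
have Ep : p * N = k%:Z * x + l%:Z * y by rewrite Ex Ey /N; ring.
have p1 : p < 1 by apply: mulN_bound; rewrite Ep /N; nia.
have p0 : 0 < p by apply: mulN_bound; rewrite Ep /N; nia.
lia.
Qed.

(* The boxes circumscribed to a face of the cube, with vertices 0, z, z + iz and
   iz, and to an edge from 0 to z, the latter widened by one row on each side;
   tiles are identified with their lower left corners. *)
Definition face_box (x y : int) :=
  [&& - l%:Z <= x, x < k%:Z, 0 <= y & y < k%:Z + l%:Z].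
Definition edge_box (x y : int) :=
  [&& 0 <= x, x < k%:Z, -1 <= y & y <= l%:Z].

Lemma translateX_face d x y : coneE (pr d) -> face_box x y -> x + 1 < k%:Z ->
  tr d (x + 1) y = X (tr d x y).
Proof.
move=> cd /and4P[h1 h2 h3 h4] h5.
apply: (translateX_box R4 AK (x0 := - l%:Z) (x1 := k%:Z) (y0 := 0) (y1 :=
  k%:Z + l%:Z)) => //; try lia.
move=> a b a1 a2 b1 b2; apply: stepXY_regular => //; apply: lattice_face_box; lia.
Qed.

Lemma translateX_edge d x y : coneE (pr d) -> edge_box x y -> x + 1 < k%:Z ->
  tr d (x + 1) y = X (tr d x y).
Proof.
move=> cd /and4P[h1 h2 h3 h4] h5.
apply: (translateX_box R4 AK (x0 := 0) (x1 := k%:Z) (y0 := -1) (y1 :=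
  l%:Z + 1)) => //; try lia.
move=> a b a1 a2 b1 b2; apply: stepXY_regular => //; apply: lattice_edge_box; lia.
Qed.

(* With [d] at 0 in the direction 1, in the chart where the dart of the cube goes
   from 0 to z, the next dart of the face leaves from z. *)
Definition face_turn (d : D) : D := R (tr d (k%:Z - 1) l%:Z).

Lemma pr_face_turn d : coneE (pr d) -> pr (face_turn d) = trE (pr d) l%:Z (- k%:Z).
Proof.
by move=> cd; rewrite /face_turn prR pr_tr turn_cone //; congr (trE _ _ _); ring.
Qed.

Lemma cone_spin d : coneE (pr d) -> coneE (pr (S d)).
Proof.
by move=> cd; have -> : pr (S d) = pr d by rewrite /spin prA !prR.
Qed.

Lemma cone_face_turn d : coneE (pr d) -> coneE (pr (face_turn d)).
Proof.
move=> cd; rewrite pr_face_turn //; apply/cone_lattice => //.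
by exists 0, (-1); split; ring.
Qed.

(** This is the change of chart [w |-> z + iw]; the [-1] appears because tiles are named by their
    lower left corners. Both sides obey the same recursion in the face box, so [translate_unique]
    applies. *)
Lemma translate_face_turn d x y : coneE (pr d) -> face_box x y ->
  tr (face_turn d) x y = R (tr d (k%:Z - 1 - y) (l%:Z + x)).
Proof.
move=> cd /and4P[h1 h2 h3 h4].
pose F x y := R (tr d (k%:Z - 1 - y) (l%:Z + x)).
have -> : face_turn d = F 0 0 by rewrite /F subr0 addr0.
apply/esym; apply: (translate_unique R4 AK (F := F)
  (x0 := - l%:Z) (x1 := k%:Z) (y0 := 0) (y1 := k%:Z + l%:Z)) => //; try lia.
  by move=> {h1 h2 h3 h4} a b a1 a2 b1 b2; rewrite /F addrA translateY.
move=> a b a1 a2 b1 b2; rewrite /F -(turn_backX A R4); congr R.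
apply: (can_inj (stepXK R4 AK)).
rewrite (backXK R4 AK) -translateX_face //; last 2 first.
- by apply/and4P; split; lia.
- by lia.
by congr tr; ring.
Qed.

Lemma spin_face_turn d :
  S (face_turn d) = R (R (tr d (k%:Z - 1) (l%:Z - 1))).
Proof.
rewrite /spin /face_turn R4 translateYB // -[in LHS](backYK R4 AK (tr _ _ _)).
by rewrite {1}/stepY AK.
Qed.

(** [S (face_turn d)] plays the role of the reversed dart of the cube, and the change of chart is
    [w |-> z - w], again shifted to lower left corners. *)
Lemma translate_edge d x y : coneE (pr d) -> edge_box x y ->
  tr (S (face_turn d)) x y = R (R (tr d (k%:Z - 1 - x) (l%:Z - 1 - y))).
Proof.
move=> cd /and4P[h1 h2 h3 h4].
pose F x y := R (R (tr d (k%:Z - 1 - x) (l%:Z - 1 - y))).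
have -> : S (face_turn d) = F 0 0 by rewrite spin_face_turn /F !subr0.
apply/esym; apply: (translate_unique R4 AK (F := F)
  (x0 := 0) (x1 := k%:Z) (y0 := -1) (y1 := l%:Z + 1)) => //; try lia.
  move=> {h1 h2 h3 h4} a b a1 a2 b1 b2; rewrite /F.
  rewrite -[X (R _)](turn_stepY _ _) -(turn_backX A R4); congr (R (R _)).
  apply: (can_inj (stepXK R4 AK)).
  rewrite (backXK R4 AK) -translateX_edge //; last 2 first.
  - by apply/and4P; split; lia.
  - by lia.
  by congr tr; ring.
move=> a b a1 a2 b1 b2; rewrite /F -(turn_backX A R4) -(turn_backY A R4);
  congr (R (R _)).
by rewrite -translateYB //; congr tr; ring.
Qed.

(** The relation [p^4 = 1] of the cube: [w |-> z + iw] has order 4. *)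
Lemma face_turn4 d : coneE (pr d) ->
  face_turn (face_turn (face_turn (face_turn d))) = d.
Proof.
move=> cd.
have c1 := cone_face_turn cd; have c2 := cone_face_turn c1.
have c3 := cone_face_turn c2.
have b0 : face_box 0 0 by apply/and4P; split; lia.
rewrite -[LHS](translate0 R A) translate_face_turn //.
rewrite translate_face_turn //; last by apply/and4P; split; lia.
rewrite translate_face_turn //; last by apply/and4P; split; lia.
rewrite translate_face_turn //; last by apply/and4P; split; lia.
rewrite R4 -[RHS](translate0 R A); congr tr; ring.
Qed.

(** The relation [(sp)^2 = 1] of the cube: [w |-> z - w] is an involution. *)
Lemma spin_face_turn2 d : coneE (pr d) -> S (face_turn (S (face_turn d))) = d.
Proof.
move=> cd; have c1 := cone_spin (cone_face_turn cd).
rewrite spin_face_turn translate_edge //; last by apply/and4P; split; lia.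
rewrite R4 -[RHS](translate0 R A); congr tr; ring.
Qed.

Hypothesis odd_kl : odd (k + l).

(** * Development of the Goldberg-Coxeter tiling *)

Section Charts.
Variable psi : cube -> D.
Hypotheses (psi_sigma : forall c, psi (sigma c) = S (psi c))
  (psi_phi : forall c, psi (phi c) = face_turn (psi c))
  (psi_cone : forall c, coneE (pr (psi c))).
Notation side := (side k l).
Notation quad_dart := (quad_dart k l).
Notation quad_class := (@quad_class k l).

(* The lower left corner of the tile with centre [w], which is doubled. *)
Definition corner (n : int) : int := ((n - 1) %/ 2)%Z.

Definition locate (d : D) (w : gauss) (u : nat) : D :=
  iter u R (tr d (corner w.1) (corner w.2)).

Definition develop (x : side) : D :=
  let: (c, w, u) := x in locate (psi c) (val w) u.

Lemma corner_odd (a : int) : odd `|a|%N -> a = 2 * corner a + 1.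
Proof. by rewrite /corner; lia. Qed.

Lemma corner_reflect (m : nat) (a : int) : odd `|a|%N ->
  corner (2 * m%:Z - a) = m%:Z - 1 - corner a.
Proof. by rewrite /corner; lia. Qed.

Lemma centre_face_box w : w \in centres k l -> face_box (corner w.1) (corner w.2).
Proof.
move=> wc; have [o1 o2 _ _] := centreP ltlk odd_kl wc.
move: wc; rewrite (mem_centres ltlk) in_squareE => /and3P[_ _ hsq].
have [h1 h2 h3 h4] := square_coord ltlk hsq.
have := corner_odd o1; have := corner_odd o2.
move: (w.1) (w.2) o1 o2 h1 h2 h3 h4 => a b *.
by apply/and4P; split; lia.
Qed.

Lemma locate_turn d w u : coneE (pr d) -> w \in centres k l ->
  locate (face_turn d) (turn_centre k l w) u = locate d w u.+1.
Proof.
move=> cd wc; have wc' := mem_turn_centre ltlk wc.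
rewrite /locate translate_face_turn ?(centre_face_box wc') // -iterSr.
have [o1 o2 _ _] := centreP ltlk odd_kl wc.
have E1 := corner_odd o1; have E2 := corner_odd o2.
congr (iter _ _ (tr _ _ _)); rewrite /turn_centre /= /corner; lia.
Qed.

Definition turn_side (x : side) : side :=
  let: (c, w, u) := x in
  (phi c, SeqSub (mem_turn_centre ltlk (valP w)), ord_pred u).

Lemma glue_turn_side x : connect (@glue k l) x (turn_side x).
Proof.
case: x => [[c w] u]; apply: connect1; apply/orP; left; apply/orP; left.
by apply/and3P; split=> //; apply/eqP; rewrite /= turn_centreE.
Qed.

Lemma iter_ord_pred (u : 'I_4) d : R (iter (ord_pred u) R d) = iter u R d.
Proof. by case: u => [[|[|[|[|u]]]] hu] //=; rewrite R4. Qed.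

Lemma develop_turn_side x : develop (turn_side x) = develop x.
Proof.
case: x => [[c w] u]; rewrite /develop /= psi_phi locate_turn ?(valP w) //.
exact: iter_ord_pred.
Qed.

(* Since k + l is odd, no tile straddles an edge of the cube. *)
Lemma across_centre_neq0 w : w \in centres k l -> across k l w != 0.
Proof. by case/(centreP ltlk odd_kl) => _ _ _; lia. Qed.

(** The other branch of [glue_step] needs a centre on an edge, which does not occur; glueing only
    identifies the four charts of a face. *)
Lemma glue_step_turn x y : glue_step x y -> y = turn_side x.
Proof.
move: x y => [[c w] u] [[c' w'] u'] /orP[/and3P[/eqP -> /eqP hw /eqP ->]|].
  congr (_, _, _); apply: val_inj; rewrite hw /=; exact: turn_centreE.
by rewrite (negbTE (across_centre_neq0 (valP w))).
Qed.

Lemma develop_glue x y : connect (@glue k l) x y -> develop x = develop y.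
Proof.
case/connectP => s; elim: s x => [|z s IH] x /=; first by move=> _ ->.
move=> /andP[xz /IH h] /h <-.
by case/orP: xz => /glue_step_turn ->; rewrite develop_turn_side.
Qed.

Lemma develop_prev c w u : R (develop (c, w, ord_pred u)) = develop (c, w, u).
Proof. exact: iter_ord_pred. Qed.

Lemma psi_alpha c : psi (alpha c) = S (face_turn (psi c)).
Proof. by rewrite -cube_sigma_phi psi_sigma psi_phi. Qed.

Lemma locate_ordS2 d w (u : 'I_4) :
  locate d w (ordS (ordS u)) = iter 2 R (locate d w u).
Proof.
by rewrite /locate; case: u => [[|[|[|[|u]]]] hu] //=; rewrite ?R4.
Qed.

(** Vertical moves hold by the definition of [translate]; horizontal ones need [hX]. The box is a
    parameter because both face boxes and edge boxes are used. *)
Lemma locate_neighbour (box : int -> int -> bool) d (w : gauss) (u : 'I_4) :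
  (forall x y, box x y -> box (x + 1) y -> tr d (x + 1) y = X (tr d x y)) ->
  odd `|w.1|%N -> odd `|w.2|%N ->
  let w1 := neighbour w u in
  box (corner w.1) (corner w.2) -> box (corner w1.1) (corner w1.2) ->
  locate d w1 (ordS (ordS u)) = A (locate d w u).
Proof.
case: w => a b hX oa ob; rewrite neighbourE; move: oa ob => /= oa ob.
have Ea := corner_odd oa; have Eb := corner_odd ob.
rewrite /locate; case: u => [[|[|[|[|u]]]] hu] //= h1 h2.
- have -> : corner (b - 2) = corner b - 1 by rewrite /corner; lia.
  by rewrite translateYB // /backY R4.
- have Ec : corner (a + 2) = corner a + 1 by rewrite /corner; lia.
  by rewrite Ec hX; [rewrite /stepX R4|exact: h1|rewrite -Ec; exact: h2].
- have -> : corner (b + 2) = corner b + 1 by rewrite /corner; lia.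
  by rewrite translateY.
- have Ec : corner a = corner (a - 2) + 1 by rewrite /corner; lia.
  by rewrite [in RHS]Ec hX; [rewrite /stepX R4 AK|exact: h2|rewrite -Ec; exact: h1].
Qed.

Lemma edge_box_reflect x y :
  edge_box x y -> edge_box (k%:Z - 1 - x) (l%:Z - 1 - y).
Proof. by case/and4P=> *; apply/and4P; split; lia. Qed.

(** Up to exchanging the tiles, one bad configuration must be excluded: [a = -1], [a' = 2k - 1],
    [b' = 2l - b]. There the second tile would have [across] equal to [l - k b], which is negative
    since [b >= 1]. *)
Lemma edge_boxes (a b a' b' : int) :
  a = 2 * corner a + 1 -> b = 2 * corner b + 1 ->
  a' = 2 * corner a' + 1 -> b' = 2 * corner b' + 1 ->
  face_box (corner a) (corner b) -> face_box (corner a') (corner b') ->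
  0 < k%:Z * b - l%:Z * a -> 0 < k%:Z * b' - l%:Z * a' ->
  (2 * k%:Z - a' = a /\ (2 * l%:Z - b' = b - 2 \/ 2 * l%:Z - b' = b + 2)) \/
  (2 * l%:Z - b' = b /\ (2 * k%:Z - a' = a - 2 \/ 2 * k%:Z - a' = a + 2)) ->
  edge_box (corner a) (corner b) /\ edge_box (corner a') (corner b').
Proof.
have aux y x' y' : 0 < y -> x' = 2 * k%:Z - 1 -> y' = 2 * l%:Z - y ->
    0 < k%:Z * y' - l%:Z * x' -> False.
  move=> y0 -> -> h; have : k%:Z * 1 <= k%:Z * y by apply: ler_wpM2l; lia.
  by move: h; rewrite mulrBr mulrBr; lia.
move=> Ea Eb Ea' Eb' /and4P[h1 h2 h3 h4] /and4P[h1' h2' h3' h4'] ac ac' nb.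
have na : a <> -1 \/ a' <> 2 * k%:Z - 1 \/ b' <> 2 * l%:Z - b.
  have [|] := eqVneq a (-1); last by lia.
  have [|] := eqVneq a' (2 * k%:Z - 1); last by lia.
  have [|] := eqVneq b' (2 * l%:Z - b); last by lia.
  move=> e1 e2 e3; exfalso; apply: (aux b a' b') => //; lia.
have na' : a' <> -1 \/ a <> 2 * k%:Z - 1 \/ b <> 2 * l%:Z - b'.
  have [|] := eqVneq a' (-1); last by lia.
  have [|] := eqVneq a (2 * k%:Z - 1); last by lia.
  have [|] := eqVneq b (2 * l%:Z - b'); last by lia.
  move=> e1 e2 e3; exfalso; apply: (aux b' a b) => //; lia.
clear aux ac ac'; rewrite /edge_box; split; apply/and4P; split; lia.
Qed.

Lemma develop_opposite x y : opposite_side x y -> develop y = A (develop x).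
Proof.
move: x y => [[c w] u] [[c' w'] u'];
  rewrite /opposite_side -[_ - _ *+ 2]/(neighbour (val w) u).
have cc := psi_cone c; have wc := valP w;
  have [o1 o2 a1 a2] := centreP ltlk odd_kl wc.
have wc' := valP w'; have [o1' o2' a1' a2'] := centreP ltlk odd_kl wc'.
case/orP=> /and3P[/eqP -> /eqP hw /eqP ->].
  rewrite /develop hw; apply: (locate_neighbour (box := face_box)) => //.
  - by move=> x y b1 /and4P[_ h _ _]; apply: translateX_face.
  - exact: centre_face_box.
  - by rewrite -hw; apply: centre_face_box.
(* Across an edge, [w1] and [w'] are the centre of the same tile, in the charts of [c] and of
   [alpha c]. *)
rewrite /develop psi_alpha; set w1 := neighbour (val w) u in hw.
have Ew1 : w1 = (2 * k%:Z - (val w').1, 2 * l%:Z - (val w').2).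
  by rewrite -z2_subE hw opprB addrC subrK.
have E1 := corner_odd o1; have E2 := corner_odd o2.
have E1' := corner_odd o1'; have E2' := corner_odd o2'.
have [e e'] : edge_box (corner (val w).1) (corner (val w).2) /\
    edge_box (corner (val w').1) (corner (val w').2).
  apply: (edge_boxes E1 E2 E1' E2' (centre_face_box wc) (centre_face_box wc')).
  - by have [] := andP a2.
  - by have [] := andP a2'.
  by have := neighbour_cases (val w) u; rewrite -/w1 Ew1.
have Ek : corner w1.1 = k%:Z - 1 - corner (val w').1 by rewrite Ew1 corner_reflect.
have El : corner w1.2 = l%:Z - 1 - corner (val w').2 by rewrite Ew1 corner_reflect.
have e1 : edge_box (corner w1.1) (corner w1.2).
  by rewrite Ek El edge_box_reflect.
rewrite -(locate_neighbour (box := edge_box)) //; last first.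
  by move=> x y b1 /and4P[_ h _ _]; apply: translateX_edge.
rewrite locate_ordS2 {1}/locate translate_edge //.
by rewrite -Ek -El -!iterSr.
Qed.

Definition side_neighbour (x : side) : gauss :=
  let: (c, w, u) := x in neighbour (val w) u.

Lemma side_neighbour_turn x :
  side_neighbour (turn_side x) = turn_centre k l (side_neighbour x).
Proof. by case: x => [[c w] u]; rewrite /= neighbour_turn. Qed.

Definition has_opposite (x : side) :=
  exists x' y', connect (@glue k l) x x' /\ opposite_side x' y'.

Lemma has_opposite_turn x : has_opposite (turn_side x) -> has_opposite x.
Proof.
move=> [x' [y' [xx' o]]]; exists x', y'; split=> //.
exact: connect_trans (glue_turn_side x) xx'.
Qed.

Lemma has_opposite_across x : across k l (side_neighbour x) < 0 -> has_opposite x.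
Proof.
case: x => [[c w] u] h; have wc := neighbour_across ltlk odd_kl (valP w) h.
exists (c, w, u), (alpha c, SeqSub wc, u); split=> //.
by apply/orP; right; apply/and3P; split.
Qed.

(** A neighbour outside the square is beyond one of its four edges, and at most three changes of
    chart turn this edge into the one from 0 to [z]. *)
Lemma has_oppositeP x : has_opposite x.
Proof.
have [wc|wnc] := boolP (side_neighbour x \in centres k l).
  case: x wc => [[c w] u] wc.
  exists (c, w, u), (c, SeqSub wc, ordS (ordS u)); split=> //.
  by apply/orP; left; apply/and3P; split.
have hi_along y : 2 * (k%:Z * k%:Z + l%:Z * l%:Z) < along k l (side_neighbour y) ->
    has_opposite y.
  move=> h; apply/has_opposite_turn/has_opposite_across.
  by rewrite side_neighbour_turn across_turn subr_lt0.
have hi_across y : 2 * (k%:Z * k%:Z + l%:Z * l%:Z) < across k l (side_neighbour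
  y) ->
    has_opposite y.
  move=> h; apply/has_opposite_turn/hi_along.
  by rewrite side_neighbour_turn along_turn.
have lo_along y : along k l (side_neighbour y) < 0 -> has_opposite y.
  move=> h; apply/has_opposite_turn/hi_across.
  by rewrite side_neighbour_turn across_turn ltrDl oppr_gt0.
have odds : odd `|(side_neighbour x).1|%N && odd `|(side_neighbour x).2|%N.
  case: (x) => [[c w] u]; have [o1 o2 _ _] := centreP ltlk odd_kl (valP w).
  exact: odd_neighbour.
move: wnc; rewrite (mem_centres ltlk) in_squareE andbA odds /=.
rewrite !negb_and -!ltNge => /or4P[]; last exact: hi_across.
- exact: lo_along.
- exact: hi_along.
- exact: has_opposite_across.
Qed.

Lemma develop_surj : (forall P : D -> Prop, (exists d, P d) ->
    (forall d, P d -> P (R d)) -> (forall d, P d -> P (A d)) -> forall d, P d) ->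
  forall d, exists x, develop x = d.
Proof.
apply.
- pose x : side := ((set0, ord0), SeqSub (centre_one ltlk odd_kl), ord0).
  by exists (develop x), x.
- move=> _ [[[c w] u] <-]; exists (c, w, ordS u).
  by rewrite -develop_prev ordSK.
move=> _ [x <-]; have [x' [y [xx' o]]] := has_oppositeP x.
by exists y; rewrite (develop_glue xx') (develop_opposite o).
Qed.

(** * Injectivity of the development, by counting *)

Section Injectivity.
Variable e0 : E.
Hypothesis psi_pr : forall c, pr (psi c) = e0 \/ pr (psi c) = trE e0 l%:Z (- k%:Z).
Hypothesis fibre : #|[set d | pr d == e0]| = 12.
Hypothesis surj : forall d, exists x, develop x = d.
Hypothesis ce0 : coneE e0.

Definition even_dart (c : cube) : bool := pr (psi c) == e0.

(** [l - ki = -iz] is not a multiple of [(1 + i)z]: dividing by [z] would give [p - q = 0] and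
    [p + q = -1]. *)
Lemma odd_period : trE e0 l%:Z (- k%:Z) != e0.
Proof.
apply/eqP => /(period _ _ ce0)[p [q [E1 E2]]].
have h1 : N * (p - q) = 0.
  have -> : N * (p - q) = k%:Z * (k%:Z * (p - q) - l%:Z * (p + q)) +
    l%:Z * (l%:Z * (p - q) + k%:Z * (p + q)) by rewrite /N; ring.
  by rewrite -E1 -E2; ring.
have h2 : N * (p + q + 1) = 0.
  have -> : N * (p + q + 1) = k%:Z * (l%:Z * (p - q) + k%:Z * (p + q)) -
    l%:Z * (k%:Z * (p - q) - l%:Z * (p + q)) + N by rewrite /N; ring.
  by rewrite -E1 -E2 /N; ring.
move/eqP: h1; move/eqP: h2; rewrite !mulf_eq0.
have /negbTE -> : N != 0 by lia.
by rewrite /= => /eqP h1 /eqP h2; lia.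
Qed.

Lemma even_dart_phi c : even_dart (phi c) = ~~ even_dart c.
Proof.
rewrite /even_dart psi_phi pr_face_turn //.
have [->|->] := psi_pr c; first by rewrite eqxx (negbTE odd_period).
rewrite (negbTE odd_period) translateD //; apply/eqP/period => //.
by exists (-1), (-1); split; lia.
Qed.

(** [phi] exchanges even and odd darts, so each kind is half of the 24. *)
Lemma card_even_dart : #|[set c | even_dart c]| = 12.
Proof.
have E1 : @phi cube @: [set c | even_dart c] = ~: [set c | even_dart c].
  apply/setP => c; rewrite !inE; apply/imsetP/idP => [[c' h ->]|h].
    by move: h; rewrite inE even_dart_phi => ->.
  exists (finv (@phi cube) c); last by rewrite (f_finv cube_phi_inj).
  by rewrite inE -[even_dart _]negbK -even_dart_phi (f_finv cube_phi_inj).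
have := cardsC [set c | even_dart c].
rewrite -E1 card_imset; last exact: cube_phi_inj.
by rewrite card_cube; lia.
Qed.

Lemma glue_even (x : side) : exists x' : side,
  connect (@glue k l) x x' /\ even_dart x'.1.1.
Proof.
case: x => [[c w] u]; have [ev|nev] := boolP (even_dart c).
  by exists (c, w, u).
exists (turn_side (c, w, u)); split; first exact: glue_turn_side.
by rewrite /= even_dart_phi.
Qed.

(* The rotations in the deck group preserving a face are those by multiples of
   180 degrees. *)
Lemma even_face_tiles e (w w' : gauss) (j : nat) : coneE e ->
  w \in centres k l -> w' \in centres k l -> (j < 4)%N ->
  trE e (corner w.1) (corner w.2) = iter j RE (trE e (corner w'.1) (corner w'.2)) ->
  (j = 0%N /\ w = w') \/
  (j = 2 /\ w = (2 * (k%:Z - l%:Z) - w'.1, 2 * (k%:Z + l%:Z) - w'.2)).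
Proof.
move=> ce wc wc'.
have [o1 o2 al ac] := centreP ltlk odd_kl wc.
have [o1' o2' al' ac'] := centreP ltlk odd_kl wc'.
have E1 := corner_odd o1; have E2 := corner_odd o2.
have E1' := corner_odd o1'; have E2' := corner_odd o2'.
move: al ac al' ac'; rewrite !alongE !acrossE -/N => al ac al' ac'.
have key (u v : int) : trE e (corner w.1) (corner w.2) = trE e (corner u)
  (corner v) ->
    odd `|u|%N -> odd `|v|%N ->
    exists p q : int, 
   [/\ k%:Z * w.1 + l%:Z * w.2 - (k%:Z * u + l%:Z * v) = 2 * N * (p - q),
       k%:Z * w.2 - l%:Z * w.1 - (k%:Z * v - l%:Z * u) = 2 * N * (p + q),
       w.1 - u = 2 * (k%:Z * (p - q) - l%:Z * (p + q)) &
       w.2 - v = 2 * (l%:Z * (p - q) + k%:Z * (p + q))].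
  move=> /eqP; rewrite translate_eq // => /eqP/(period _ _ ce)[p [q [F1 F2]]] ou ov.
  have Eu := corner_odd ou; have Ev := corner_odd ov.
  have G1 : w.1 - u = 2 * (k%:Z * (p - q) - l%:Z * (p + q)) by lia.
  have G2 : w.2 - v = 2 * (l%:Z * (p - q) + k%:Z * (p + q)) by lia.
  exists p, q; split=> //.
    have -> : k%:Z * w.1 + l%:Z * w.2 - (k%:Z * u + l%:Z * v) =
      k%:Z * (w.1 - u) + l%:Z * (w.2 - v) by ring.
    by rewrite G1 G2 /N; ring.
  have -> : k%:Z * w.2 - l%:Z * w.1 - (k%:Z * v - l%:Z * u) =
    k%:Z * (w.2 - v) - l%:Z * (w.1 - u) by ring.
  by rewrite G1 G2 /N; ring.
have small (m x : int) : x = 2 * N * m -> - (2 * N) < x -> x < 2 * N -> m = 0.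
  move=> -> h1 h2; have : -1 < m by rewrite -(ltr_pM2l (_ : 0 < 2 * N)) ?mulrN1
    //; lia.
  have : m < 1 by rewrite -(ltr_pM2l (_ : 0 < 2 * N)) ?mulr1 //; lia.
  lia.
have small1 (m x : int) : x = 2 * N * m -> 0 < x -> x < 4 * N -> m = 1.
  move=> Em h1 h2; suff : m - 1 = 0 by lia.
  by apply: (@small _ (x - 2 * N)); rewrite ?Em ?mulrBr ?mulr1 //; lia.
have cN (x : int) : odd `|x|%N ->
  corner (- x) = - corner x - 1 by rewrite /corner; lia.
have oN (x : int) : odd `|x|%N -> odd `|- x|%N by lia.
set a := k%:Z * w.1 + l%:Z * w.2 in al key.
set b := k%:Z * w.2 - l%:Z * w.1 in ac key.
(* The bounds of the square determine [p - q] and [p + q]. For [j] equal to 1 or 3 their parities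
   differ, which is absurd; for [j = 2] both are 1, giving the half turn about the centre of the
   square. *)
case: j => [|[|[|[|j]]]] // _ /= h.
- left; split=> //; have [p [q [F1 F2 F3 F4]]] := key _ _ h o1' o2'.
  have m1 : p - q = 0 by apply: small F1 _ _; lia.
  have m2 : p + q = 0 by apply: small F2 _ _; lia.
  by move: F3 F4; rewrite m1 m2; case: (w) (w') => [x y] [x' y'] /= *;
    congr pair; lia.
- rewrite turn_cone // -cN // in h.
  have [p [q [F1 F2 _ _]]] := key _ _ h o2' (oN _ o1').
  have m1 : p - q = 0 by apply: small F1 _ _; lia.
  have m2 : p + q = 1 by apply: small1 F2 _ _; lia.
  lia.
- rewrite !turn_cone // -!cN // in h.
  have [p [q [F1 F2 F3 F4]]] := key _ _ h (oN _ o1') (oN _ o2').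
  have m1 : p - q = 1 by apply: small1 F1 _ _; lia.
  have m2 : p + q = 1 by apply: small1 F2 _ _; lia.
  right; split=> //.
  by move: F3 F4; rewrite m1 m2; case: (w) (w') => [x y] [x' y'] /= *;
    congr pair; lia.
- rewrite !turn_cone // opprD !opprK addrK -cN // in h.
  have [p [q [F1 F2 _ _]]] := key _ _ h (oN _ o2') o1'.
  have m1 : p - q = 1 by apply: small1 F1 _ _; lia.
  have m2 : p + q = 0 by apply: small F2 _ _; lia.
  lia.
Qed.

(** By [even_face_tiles] the two tiles agree up to a half turn of the face, which two changes of
    chart absorb. *)
Lemma match_even_sides (x y : side) : even_dart x.1.1 -> even_dart y.1.1 ->
  pr (develop x) = pr (develop y) ->
  exists y' : side, [/\ connect (@glue k l) y y', even_dart y'.1.1 &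
    y' = (y'.1.1, x.1.2, x.2)].
Proof.
case: x y => [[c w] u] [[c' w'] u'] /= /eqP ec /eqP ec'.
have pr_locate d v m : pr (locate d v m) =
    iter m RE (trE (pr d) (corner v.1) (corner v.2)).
  by rewrite -pr_tr /locate; elim: m => //= m <-; rewrite prR.
have mod4 m e : iter m RE e = iter (m %% 4) RE e.
  by rewrite [in LHS](divn_eq m 4) addnC iterD mulnC iter_turn4.
rewrite !pr_locate ec ec' => h.
have {h} h : trE e0 (corner (val w).1) (corner (val w).2) =
    iter ((u' + (4 - u)) %% 4) RE (trE e0 (corner (val w').1) (corner (val w').2)).
  rewrite -mod4 addnC iterD -h -iterD subnK; last exact: ltnW.
  by rewrite /= R4E.
have j4 : ((u' + (4 - u)) %% 4 < 4)%N by rewrite ltn_mod.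
case: (even_face_tiles ce0 (valP w) (valP w') j4 h) => [[j0 ww]|[j2 ww]].
  exists (c', w', u'); split=> //=; first exact/eqP.
  congr (_, _, _); first exact: val_inj.
  by apply: val_inj; have := ltn_ord u; have := ltn_ord u'; move: j0 => /=; lia.
exists (turn_side (turn_side (c', w', u'))); split.
- exact: connect_trans (glue_turn_side _) (glue_turn_side _).
- by rewrite /= !even_dart_phi negbK; apply/eqP.
congr (_, _, _); first apply: val_inj.
  by rewrite ww /turn_centre /=; congr pair; lia.
apply: val_inj; have := ltn_ord u; have := ltn_ord u'; move: j2 => /=.
by case: u' {h j4} => [[|[|[|[|u']]]] hu'] //=; lia.
Qed.

(** By surjectivity of [develop], the images of the 12 even darts cover the fibre of [e0], which has
    12 elements; so they are distinct. *)
Lemma psi_even_inj : {in [set c | even_dart c] &, injective psi}.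
Proof.
apply/imset_injP; rewrite eqn_leq leq_imset_card card_even_dart -fibre.
apply/subset_leq_card/subsetP => d; rewrite inE => /eqP prd.
have [x Ex] := surj d; have [x' [xx' ev]] := glue_even x.
have [c0 ev0] : exists c0, even_dart c0.
  have /card_gt0P[c0] : (0 < #|[set c | even_dart c]|)%N by rewrite card_even_dart.
  by rewrite inE; exists c0.
(* The bottom side of the tile with doubled centre [(1, 1)], at the origin of the chart, develops to
   [psi c0] itself. *)
pose y : side := (c0, SeqSub (centre_one ltlk odd_kl), ord0).
have [|y' [x'y' ev' Ey']] := match_even_sides (x := y) (y := x') ev0 ev.
  by rewrite -(develop_glue xx') Ex prd /y /develop /locate /=; apply/eqP.
apply/imsetP; exists y'.1.1; first by rewrite inE.
by rewrite -Ex (develop_glue xx') (develop_glue x'y') Ey'.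
Qed.

Lemma iter_turn_inj m : injective (iter m R).
Proof.
have Rinj : injective R by move=> d e /(congr1 (iter 3 R)); rewrite /= !R4.
by elim: m => // m IH d e /= /Rinj /IH.
Qed.

Lemma develop_inj (x y : side) : develop x = develop y -> connect (@glue k l) x y.
Proof.
move=> h; have [x' [xx' ex']] := glue_even x; have [y' [yy' ey']] := glue_even y.
have h' : develop x' = develop y' by rewrite -(develop_glue xx') -(develop_glue
  yy').
have [y2 [y'y2 ey2 E2]] := match_even_sides ex' ey' (congr1 pr h').
rewrite (develop_glue y'y2) E2 in h'.
have gs := @glue_connect_sym k l.
apply: connect_trans xx' _; rewrite gs; apply: connect_trans yy' _.
apply: connect_trans y'y2 _; rewrite E2.
move: h'; case: x' ex' {E2} => [[c w] u] ex' /=.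
move/iter_turn_inj/(translate_inj R4 AK)/psi_even_inj => -> //; by rewrite inE.
Qed.

Definition quad_develop (q : quad_dart) : D := develop (val q).

Lemma quad_develop_class x : quad_develop (quad_class x) = develop x.
Proof.
rewrite /quad_develop /=; apply/esym/develop_glue; exact: connect_root.
Qed.

Lemma quad_classK q : quad_class (val q) = q.
Proof. by apply: val_inj => /=; apply/eqP/(valP q). Qed.

Lemma quad_develop_inj : injective quad_develop.
Proof.
move=> q q' /develop_inj /(fingraph.rootP (@glue_connect_sym k l)) h.
by rewrite -(quad_classK q) -(quad_classK q'); apply: val_inj.
Qed.

Lemma quad_develop_prev q : quad_develop q = R (quad_develop (quad_prev q)).
Proof.
rewrite /quad_prev {1}/quad_develop; case: (val q) => [[c w] u].
by rewrite quad_develop_class develop_prev.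
Qed.

Lemma quad_develop_alpha q : quad_develop (quad_alpha q) = A (quad_develop q).
Proof.
rewrite /quad_alpha; case: pickP => [e /existsP[x /existsP[y /and3P[]]]|/= none].
  move=> /eqP <- /eqP <- /develop_opposite; by rewrite !quad_develop_class.
have [x [y [qx o]]] := has_oppositeP (val q).
have /negP[] := negbT (none (quad_class y)); apply/existsP; exists x.
apply/existsP; exists y; apply/and3P; split=> //.
rewrite -[X in _ == X](quad_classK q); apply/eqP/val_inj/esym => /=.
exact/(fingraph.rootP (@glue_connect_sym k l)).
Qed.

Lemma quad_develop_surj d : exists q, quad_develop q = d.
Proof. by have [x <-] := surj d; exists (quad_class x);
  rewrite quad_develop_class. Qed.

End Injectivity.

End Charts.

(** [S] and [face_turn] satisfy the relations of the cube over cones, which provides [psi]. The two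
    possible classes of [pr (psi c)] are exchanged by [face_turn] and kept by [S]. *)
Lemma quadrangulation_develop d0 : coneE (pr d0) ->
  #|[set d | pr d == pr d0]| = 12 ->
  (forall P : D -> Prop, (exists d, P d) -> (forall d, P d -> P (R d)) ->
     (forall d, P d -> P (A d)) -> forall d, P d) ->
  exists f : quad_dart k l -> D, [/\ bijective f,
    forall q, f (quad_alpha q) = A (f q) & forall q, f q = R (f (quad_prev q))].
Proof.
move=> cd0 fibre trans.
have [psi [psi_s psi_p psi_ind]] := cube_presentation (C := fun d => coneE (pr d))
  cone_spin cone_face_turn cone3 face_turn4 spin_face_turn2 cd0.
have psi_cone c : coneE (pr (psi c)).
  by apply: (psi_ind (fun d => coneE (pr d))) => // d _ cd;
    [apply: cone_spin|apply: cone_face_turn].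
have psi_pr c : pr (psi c) = pr d0 \/ pr (psi c) = trE (pr d0) l%:Z (- k%:Z).
  apply: (psi_ind (fun d => pr d = pr d0 \/ pr d = trE (pr d0) l%:Z (- k%:Z))).
  - by left.
  - by move=> d cd h; have -> : pr (S d) = pr d by rewrite /spin prA !prR.
  move=> d cd; rewrite pr_face_turn // => -[->|->]; [by right|left].
  (* Twice [-iz] is the period [(1 + i)z(-1 - i)]. *)
  by rewrite translateD //; apply/period => //; exists (-1), (-1); split; lia.
have surj := develop_surj psi_s psi_p psi_cone trans.
have inj := quad_develop_inj psi_p psi_cone psi_pr fibre surj cd0.
have qsurj d : exists q, quad_develop psi q == d.
  by have [q <-] := quad_develop_surj psi_p psi_cone surj d; exists q.
exists (quad_develop psi); split.
- exists (fun d => xchoose (qsurj d)) => [q|d];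
  last exact: (eqP (xchooseP (qsurj d))).
  by apply: inj; exact: (eqP (xchooseP (qsurj _))).
- by move=> q; rewrite quad_develop_alpha.
- by move=> q; rewrite -quad_develop_prev.
Qed.

End Development.

(** * The quotient by the rotation group *)

(* [col] is the class of the target of a side in the 2-colouring of the vertices. *)
Section TetrahedralTiling.
Local Open Scope ring_scope.
Variables (D : finType) (R A : D -> D).
Variables (gT : finGroupType) (H : {group gT}) (act : gT -> D -> D).
Hypotheses (R4 : forall d, R (R (R (R d))) = d) (AK : involutive A).
Hypotheses (act1 : forall d, act 1%g d = d)
  (actM : forall g h d, g \in H -> h \in H -> act (g * h)%g d = act h (act g d))
  (actR : forall h d, h \in H -> act h (R d) = R (act h d))
  (actA : forall h d, h \in H -> act h (A d) = A (act h d))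
  (act_free : forall h d, h \in H -> act h d = d -> h = 1%g).
Hypothesis cardH : #|H| = 12.
Notation S := (spin R A).
Hypothesis spin34 : forall d, S (S (S d)) = d \/ S (S (S (S d))) = d.
Hypothesis spin_act : forall d, S (S (S d)) = d <-> exists2 h,
  h \in H & S d = act h d.
Hypothesis trans : forall P : D -> Prop, (exists d, P d) ->
  (forall d, P d -> P (R d)) -> (forall d, P d -> P (A d)) -> forall d, P d.
Variable col : D -> bool.
Hypotheses (colR : forall d, col (R d) = ~~ col d)
  (colA : forall d, col (A d) = ~~ col d)
  (col_act : forall h d, h \in H -> col (act h d) = col d)
  (col_cone : forall b, exists2 d, S (S (S d)) = d & col d = b).

Let orb (d : D) : {set D} := [set act h d | h in H].

Let orbP d d' : reflect (exists2 h, h \in H & d' = act h d) (orb d == orb d').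
Proof.
apply: (iffP eqP) => [E|[h hH ->]].
  have /imsetP[h hH Ed] : d' \in orb d.
    by rewrite E; apply/imsetP; exists 1%g; rewrite ?group1 ?act1.
  by exists h.
apply/setP=> e; apply/imsetP/imsetP => -[g gH ->].
  exists (h^-1 * g)%g; first by rewrite groupM ?groupV.
  by rewrite -actM ?groupM ?groupV // mulgA mulgV mul1g.
by exists (h * g)%g; rewrite ?groupM ?actM.
Qed.

Notation E := {B : {set D} | B \in codom orb}.

Definition deck_class (d : D) : E := exist _ (orb d) (codom_f orb d).
Definition deck_repr (e : E) : D := iinv (valP e).

Lemma deck_classP d d' : reflect (exists2 h,
  h \in H & d' = act h d) (deck_class d == deck_class d').
Proof. exact: orbP. Qed.

Lemma deck_reprK e : deck_class (deck_repr e) = e.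
Proof. by apply: val_inj; rewrite /= f_iinv. Qed.

Definition deck_turn e := deck_class (R (deck_repr e)).
Definition deck_cross e := deck_class (A (deck_repr e)).

Lemma deck_class_turn d : deck_class (R d) = deck_turn (deck_class d).
Proof.
have /eqP/deck_classP[h hH E1] := esym (deck_reprK (deck_class d)).
by apply/eqP/deck_classP; exists h; rewrite // E1 actR.
Qed.

Lemma deck_class_cross d : deck_class (A d) = deck_cross (deck_class d).
Proof.
have /eqP/deck_classP[h hH E1] := esym (deck_reprK (deck_class d)).
by apply/eqP/deck_classP; exists h; rewrite // E1 actA.
Qed.

(** A spin becomes trivial in the quotient when an element of [H] realizes it; by [spin_act] this
    happens exactly at the points of order 3. *)
Lemma cone_deck_class d : cone deck_turn deck_cross (deck_class d) <-> S (S (S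
  d)) = d.
Proof.
rewrite /cone /spin -!(deck_class_turn, deck_class_cross) spin_act;
  split=> [/esym/eqP/deck_classP//|h].
by apply/esym/eqP/deck_classP.
Qed.

Lemma card_deck_class d : #|[set d' | deck_class d' == deck_class d]| = 12.
Proof.
have -> : [set d' | deck_class d' == deck_class d] = orb d.
  apply/setP=> d'; rewrite inE eq_sym; apply/deck_classP/imsetP => -[h hH ->];
    by exists h.
rewrite card_in_imset ?cardH // => g h gH hH Egh.
apply: (mulIg h^-1%g); rewrite mulgV; apply: (act_free (d := d)).
  by rewrite groupM ?groupV.
by rewrite actM ?groupV // Egh -actM ?groupV // mulgV act1.
Qed.

Lemma deck_turn4 e : deck_turn (deck_turn (deck_turn (deck_turn e))) = e.
Proof. by rewrite -(deck_reprK e) -!deck_class_turn R4. Qed.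

Lemma deck_crossK : involutive deck_cross.
Proof. by move=> e; rewrite -(deck_reprK e) -!deck_class_cross AK. Qed.

Lemma regular_deck_class d : S (S (S (S d))) = d \/ cone deck_turn deck_cross
  (deck_class d).
Proof. by rewrite cone_deck_class; case: (spin34 d); auto. Qed.

Lemma deck_spin4 e : spin deck_turn deck_cross (spin deck_turn deck_cross (spin
  deck_turn deck_cross (spin deck_turn deck_cross e))) = e.
Proof.
rewrite -(deck_reprK e); case: (regular_deck_class (deck_repr e)) => [h|h];
  last by rewrite !h.
by rewrite -[in RHS]h /spin !(deck_class_turn, deck_class_cross).
Qed.

Lemma deck_period_lattice : exists k l : nat, [/\ (0 < k)%N, odd (k + l) &
    forall e a b, cone deck_turn deck_cross e ->
      translate deck_turn deck_cross e a b = e <-> exists p q : int,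
      a = k%:Z * (p - q) - l%:Z * (p + q) /\
      b = l%:Z * (p - q) + k%:Z * (p + q)].
Proof.
pose colE e := col (deck_repr e).
have colE_pr d : colE (deck_class d) = col d.
  have /eqP/deck_classP[h hH E1] := esym (deck_reprK (deck_class d)).
  by rewrite /colE E1 col_act.
apply: (cone_period_lattice deck_turn4 deck_crossK deck_spin4 _ (_ : forall e,
  exists2 n, (0 < n)%N & iter n (stepX deck_turn deck_cross) e = e) (_ : forall
    e, colE (deck_turn e) = ~~ colE e)).
- move=> P e Pe PR PA f; rewrite -(deck_reprK f).
  apply: (trans (P := fun d => P (deck_class d))) => [|d|d]; last 2 first.
  + by rewrite deck_class_turn; apply: PR.
  + by rewrite deck_class_cross; apply: PA.
  by exists (deck_repr e); rewrite deck_reprK.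
- move=> e; have Xinj := can_inj (stepXK R4 AK).
  exists (fingraph.order (stepX R A) (deck_repr e));
    first exact: fingraph.order_gt0.
  have it n d : iter n (stepX deck_turn deck_cross) (deck_class d) = deck_class
    (iter n (stepX R A) d).
    by elim: n => //= n ->; rewrite /stepX !(deck_class_turn, deck_class_cross).
  by have := it (fingraph.order (stepX R A) (deck_repr e)) (deck_repr e);
    rewrite iter_order // deck_reprK.
- by move=> e; rewrite -(deck_reprK e) -deck_class_turn !colE_pr colR.
- by move=> e; rewrite -(deck_reprK e) -deck_class_cross !colE_pr colA.
by move=> b; have [d /cone_deck_class cd cb] := col_cone b;
  exists (deck_class d); rewrite ?colE_pr.
Qed.

Let R' d := R (R (R d)).
Let RE' e := deck_turn (deck_turn (deck_turn e)).

(** Reversing the turns exchanges left and right but keeps the upward direction. *)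
Lemma translate_mirror (T : Type) (r a : T -> T) e x y :
  (forall d, r (r (r (r d))) = d) -> involutive a ->
  translate (fun d => r (r (r d))) a e x y = translate r a e (- x) y.
Proof.
move=> r4 aK; rewrite /translate ziter_swap.
rewrite (@ziter_morph _ _ _ _ (stepY r a) (backY r a) id); first last.
- by move=> d; rewrite /backY !r4.
- by move=> d; rewrite /stepY !r4.
congr (ziter _ _ _ _); apply: (@ziter_morph _ _ _ _ _ _ id) => d.
- by rewrite /stepX /backX.
by rewrite /stepX /backX !r4.
Qed.

(** Parity excludes [k = l]. When [k < l], the tiling is read with the opposite orientation, through
    [R'], which replaces [k + li] by its mirror image [l + ki]. *)
Lemma tetrahedral_tiling : exists k l : nat, [/\ (l < k)%N, odd (k + l) &
  (exists f : quad_dart k l -> D, [/\ bijective f,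
    forall q, f (quad_alpha q) = A (f q) & forall q, f q = R (f (quad_prev q))]) \/
  (exists f : quad_dart k l -> D, [/\ bijective f,
    forall q, f (quad_alpha q) = A (f q) & forall q, f q = R' (f (quad_prev q))])].
Proof.
have [k [l [k0 okl per]]] := deck_period_lattice.
have [d0 /cone_deck_class cd0 _] := col_cone true.
have [lk|kl|kl] := ltngtP l k; last by lia.
  exists k, l; split=> //; left.
  apply: (quadrangulation_develop R4 AK deck_turn4 deck_crossK deck_spin4
    deck_class_turn deck_class_cross regular_deck_class _ per lk okl cd0 _ trans).
    by move=> d /cone_deck_class.
  exact: card_deck_class.
exists l, k; split=> //; first by rewrite addnC.
right.
have R4' d : R' (R' (R' (R' d))) = d by rewrite /R' !R4.
have RE4' e : RE' (RE' (RE' (RE' e))) = e by rewrite /RE' !deck_turn4.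
have S' d : spin R' A (A d) = A (R (A d)) by rewrite /spin /R' !R4.
(* Reversing the orientation exchanges the two ends of a side: [spin] for [R'] is the inverse of
   [S], conjugated by [A]. *)
have S'V d : S (A (spin R' A d)) = A d by rewrite /spin /R' !(R4, AK).
have SE'V e : spin deck_turn deck_cross (deck_cross (spin RE' deck_cross e)) =
  deck_cross e by rewrite /spin /RE' !(deck_turn4, deck_crossK).
have cone' e : cone RE' deck_cross e <-> cone deck_turn deck_cross (deck_cross e).
  rewrite /cone; split=> h; first by have := SE'V e; rewrite h.
  by apply: (can_inj deck_crossK); apply: (spin_inj deck_turn4 deck_crossK);
    rewrite SE'V h.
have S3' d : S (S (S (A d))) = A d -> spin R' A (spin R' A (spin R' A d)) = d.
  by move=> h; apply: (can_inj AK); do 3 apply: (spin_inj R4 AK); rewrite !S'V h.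
have S4' d : S (S (S (S (A d)))) = A d ->
    spin R' A (spin R' A (spin R' A (spin R' A d))) = d.
  by move=> h; apply: (can_inj AK); do 4 apply: (spin_inj R4 AK); rewrite !S'V h.
have SE4' e : spin RE' deck_cross (spin RE' deck_cross (spin RE' deck_cross
  (spin RE' deck_cross e))) = e.
  apply: (can_inj deck_crossK); do 4 apply: (spin_inj deck_turn4 deck_crossK).
  by rewrite !SE'V deck_spin4.
have prR' d : deck_class (R' d) = RE' (deck_class d) by rewrite /R'
  !deck_class_turn.
have cd1 : cone RE' deck_cross (deck_class (A d0)) by apply/cone';
  rewrite -deck_class_cross AK.
apply: (quadrangulation_develop R4' AK RE4' deck_crossK SE4' prR'
  deck_class_cross _ _ _ kl _ cd1 _).
- move=> d; rewrite cone' -deck_class_cross; case: (regular_deck_class (A d)); auto.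
- by move=> d /cone'; rewrite -deck_class_cross => /cone_deck_class/S3'.
- move=> e a b /cone' ce; rewrite translate_mirror;
  [|exact: deck_turn4|exact: deck_crossK].
  have Ef : deck_cross e = deck_turn e.
    have /coneP := ce; move/(_ deck_turn4 deck_crossK); rewrite /backY deck_crossK.
    by move/(congr1 (iter 3 deck_turn)); rewrite /= !deck_turn4.
  have -> : translate deck_turn deck_cross e (- a) b = e <->
      translate deck_turn deck_cross (deck_cross e) b a = deck_cross e.
    rewrite Ef -[in X in _ <-> X](opprK a) -(turn_translate deck_turn4
      deck_crossK deck_spin4).
    by split=> [->//|/(congr1 (iter 3 deck_turn))]; rewrite /= !deck_turn4.
  (* The reflection [a + bi |-> b + ai] takes [(k + li)(1 + i)(p + qi)] to
     [(l + ki)(1 + i)(-q - pi)]. *)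
  rewrite per //; split=> -[p [q [-> ->]]]; exists (- q), (- p); split; ring.
- by rewrite addnC.
- exact: card_deck_class.
move=> P ex PR' PA; apply: trans => // d Pd.
by have := PR' _ (PR' _ (PR' _ Pd)); rewrite /R' !R4.
Qed.

End TetrahedralTiling.

(** * The tiling of a self-hedrite *)

Section Orders.
Variable T : finType.

Lemma order_min (f : T -> T) x n :
  0 < n -> iter n f x = x -> fingraph.order f x <= n.
Proof.
move=> n0 E; rewrite leqNgt; apply/negP => lt.
by have := findex_iter lt; rewrite E findex0 => En; rewrite -En in n0.
Qed.

Lemma order_eqP (f : T -> T) x n : injective f -> 0 < n ->
  (forall m, 0 < m < n -> iter m f x <> x) ->
  iter n f x = x -> fingraph.order f x = n.
Proof.
move=> injf n0 hm E; apply/eqP; rewrite eqn_leq order_min //= leqNgt.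
apply/negP => lt; apply: (hm (fingraph.order f x)); last exact: iter_order.
by rewrite fingraph.order_gt0.
Qed.

Lemma order_iter (f : T -> T) x : injective f ->
  fingraph.order f (f x) = fingraph.order f x.
Proof.
by move=> injf; apply/(orbitPcycle 4 1)/iter_order.
Qed.

Lemma card_order_set (f : T -> T) n : injective f ->
  fcard f (order_set f n) * n = #|order_set f n|.
Proof.
move=> injf; apply: fcard_order_set => // x y /eqP <-.
by rewrite !inE order_iter.
Qed.

Lemma card_split234 (P : pred T) (h : T -> nat) : (forall x, 2 <= h x <= 4) ->
  #|P| = #|[predI P & [pred x | h x == 2]]| + #|[predI P & [pred x | h x == 3]]| +
         #|[predI P & [pred x | h x == 4]]|.
Proof.
move=> hh; rewrite -!sum1_card.
rewrite (big_mkcond (mem P)) (big_mkcond (mem [predI P & [pred x | h x == 2]])).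
rewrite (big_mkcond (mem [predI P & [pred x | h x == 3]])).
rewrite (big_mkcond (mem [predI P & [pred x | h x == 4]])) -!big_split /=.
apply: eq_bigr => x _; rewrite !inE; move: (hh x); rewrite -[x \in P]/(P x).
by case: (P x); case: (h x) => [|[|[|[|[|n]]]]].
Qed.

Lemma fcard_orders234 (f : T -> T) : (forall x, 2 <= fingraph.order f x <= 4) ->
  fcard f predT = fcard f (order_set f 2) + fcard f (order_set f 3) +
                  fcard f (order_set f 4).
Proof.
move=> h; rewrite /n_comp_mem (card_split234 _ h).
by congr (_ + _ + _); apply: eq_card => x; rewrite !inE andbT.
Qed.

Lemma card_orders234 (f : T -> T) : (forall x, 2 <= fingraph.order f x <= 4) ->
  #|T| = #|order_set f 2| + #|order_set f 3| + #|order_set f 4|.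
Proof.
move=> h; rewrite -[LHS]/(#|predT|) [LHS](card_split234 _ h).
by congr (_ + _ + _); apply: eq_card => x; rewrite !inE.
Qed.
End Orders.

(** Only return times are compared, so that a map carrying [f] to the inverse of [g], such as an
    orientation-reversing isomorphism, is covered too. *)
Lemma order_set_iso (T U : finType) (f : T -> T) (g : U -> U) (h : T -> U) n :
  injective f -> injective g -> bijective h ->
  (forall m x, iter m f x = x <-> iter m g (h x) = h x) ->
  #|order_set f n| = #|order_set g n|.
Proof.
move=> injf injg bijh E; rewrite -(card_image (bij_inj bijh)).
have Eo x : fingraph.order f x = fingraph.order g (h x).
  apply/eqP; rewrite eqn_leq; apply/andP; split; apply: order_min;
    rewrite ?fingraph.order_gt0 //.
    by apply/E; rewrite iter_order.
  by apply/E; rewrite iter_order.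
have [h' hK h'K] := bijh; apply: eq_card => y; rewrite !inE.
apply/imageP/eqP => [[x] |]; first by rewrite inE Eo => /eqP <- ->.
by move=> Ey; exists (h' y); rewrite ?h'K // inE Eo h'K Ey.
Qed.

(** * Degrees and face sizes of a self-hedrite *)

Section SelfHedrites.
Variable G : cmap.
Hypothesis hG : self_hedrite4 G.

Let pG : plane_graph G. Proof. by case: hG. Qed.
Let sinj : injective (@sigma G) := pg_sigma pG.
Let alphaK : involutive (@alpha G) := pg_alpha pG.

Lemma sigma_phi (x : G) : sigma (phi x) = alpha x.
Proof. exact: f_finv. Qed.

Lemma phi_inj : injective (@phi G).
Proof. by move=> x y /(congr1 sigma); rewrite !sigma_phi => /(inv_inj alphaK). Qed.

Lemma card_order_sigma_phi n : #|order_set (@sigma G) n| = #|order_set (@phi G) n|.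
Proof.
have [_ [rev [f [bf _ fs]]] _ _ _] := hG.
have injf := bij_inj bf.
apply: (order_set_iso n sinj phi_inj bf) => m x; case: rev fs => fs; last first.
  have -> : iter m (@phi G) (f x) = f (iter m sigma x) by elim: m => //= m ->;
    rewrite fs.
  by split=> [->|/injf].
have E y : iter m (@phi G) (f (iter m sigma y)) = f y.
  elim: m y => // m IH y; rewrite iterS iterSr IH; exact: fs.
have piter : injective (iter m (@phi G)).
  by elim: m {E} => // m IH y z /phi_inj/IH.
split=> h; first by rewrite -[RHS](E x) h.
by apply/injf/piter; rewrite E h.
Qed.

(** Self-duality gives V = F, so V + F = E + 2 and 2E = 2p_2 + 3p_3 + 4p_4 yield 2p_2 + p_3 = 4.
    With p_2 + p_3 = 4 this forces p_2 = 0 and p_3 = 4, hence 12 darts on triangles. *)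
Let sizes : [/\ #|order_set (@phi G) 2| = 0, #|order_set (@phi G) 3| = 12 &
  #|G| = #|order_set (@phi G) 3| + #|order_set (@phi G) 4|].
Proof.
have [_ _ degs faces p23] := hG.
have /= e := pg_euler pG; rewrite /euler_sphere in e.
have cV := fcard_orders234 degs; have cF := fcard_orders234 faces.
have cG := card_orders234 faces.
have cs n := card_order_set n sinj; have cp n := card_order_set n phi_inj.
have cA : fcard (@alpha G) predT * 2 = #|G|.
  apply: (fcard_order_set (inv_inj alphaK) (a := predT)) => //.
  apply/subsetP => x _; rewrite inE; apply/eqP/order_eqP => //.
  - exact: inv_inj alphaK.
  - by case=> [|[|m]] //= _; apply/eqP/(pg_nofix pG).
  - exact: alphaK.
have s2 := cs 2; have s3 := cs 3; have s4 := cs 4.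
have f2 := cp 2; have f3 := cp 3; have f4 := cp 4.
rewrite !card_order_sigma_phi in s2 s3 s4.
rewrite /num_faces in p23.
move: (fcard sigma (order_set sigma 2)) (fcard sigma (order_set sigma 3)) cV s2 s3.
move: (fcard sigma (order_set sigma 4)) s4 (fcard phi (order_set phi 4)) cF f4.
move: (fcard phi (order_set phi 2)) (fcard phi (order_set phi 3)) f2 f3 p23.
move: (fcard sigma predT) (fcard phi predT) (fcard alpha predT) e cA.
move: #|order_set phi 2| #|order_set phi 3| #|order_set phi 4| #|G| cG.
by clear; move=> *; split; lia.
Qed.

Lemma face_size34 (x : G) : face_size x = 3 \/ face_size x = 4.
Proof.
have [s2 _ _] := sizes; have [_ _ _ faces _] := hG; have := faces x.
have : x \notin order_set (@phi G) 2 by have /card0_eq -> := s2.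
rewrite inE /face_size; case: (fingraph.order _ _) => [|[|[|[|[|n]]]]] //; auto.
Qed.

Lemma vertex_degree34 (x : G) : vertex_degree x = 3 \/ vertex_degree x = 4.
Proof.
have [s2 _ _] := sizes; have [_ _ degs _ _] := hG; have := degs x.
rewrite -card_order_sigma_phi in s2.
have : x \notin order_set (@sigma G) 2 by have /card0_eq -> := s2.
rewrite inE /vertex_degree; case: (fingraph.order _ _) => [|[|[|[|[|n]]]]] //; auto.
Qed.

Lemma card_triangle_darts : #|order_set (@phi G) 3| = 12.
Proof. by case: sizes. Qed.

Lemma card_trivalent_darts : #|order_set (@sigma G) 3| = 12.
Proof. by rewrite card_order_sigma_phi card_triangle_darts. Qed.

End SelfHedrites.

(** * Some rotations of the tetrahedron as matrices *)

Section TetrahedralGroup.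
Local Open Scope ring_scope.
Variable F : rcfType.

Let rot : {perm 'I_3} := perm (can_inj (@ordSK 3)).

Let rot3 : (rot * rot * rot)%g = 1%g.
Proof.
apply/permP => i; rewrite !permM !permE; apply/val_inj.
by case: i => [[|[|[|i]]]].
Qed.

Definition cyclic_mx : 'M[F]_3 := perm_mx rot.

Lemma T_group_cyclic : T_group cyclic_mx.
Proof.
split; last first.
  (* [rot] is an even permutation because its cube is 1. *)
  rewrite /cyclic_mx det_perm; have := congr1 (@odd_perm _) rot3.
  by rewrite !odd_permM odd_perm1; case: (odd_perm rot).
split; first by rewrite /cyclic_mx tr_perm_mx -perm_mxM mulgV perm_mx1.
move=> v [v1 vp]; rewrite /cyclic_mx -[rot]invgK -col_permE; split=> [j|].
  by rewrite mxE.
rewrite -[RHS]vp [RHS](reindex_inj (@perm_inj _ rot^-1%g)).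
by apply: eq_bigr => j _; rewrite mxE.
Qed.

Lemma cyclic_mx3 : cyclic_mx *m cyclic_mx *m cyclic_mx = 1%:M.
Proof. by rewrite /cyclic_mx -!perm_mxM rot3 perm_mx1. Qed.

Lemma cyclic_mx_neq1 : cyclic_mx <> 1%:M.
Proof.
move/matrixP/(_ 0 0); rewrite !mxE !permE /= => /eqP.
by rewrite eq_sym oner_eq0.
Qed.

Definition sign_row (k : 'I_3) : 'rV[F]_3 := \row_j (if j == k then 1 else -1).
(** The half turn about the [k]-th coordinate axis. *)
Definition flip_mx (k : 'I_3) : 'M[F]_3 := diag_mx (sign_row k).

Let prod_sign k : \prod_j sign_row k 0 j = 1.
Proof.
rewrite !big_ord_recl big_ord0 !mxE.
by case: k => [[|[|[|k]]] hk] //=; rewrite ?mulr1 ?mul1r ?mulrNN ?mulr1.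
Qed.

Let sign_sq k j : sign_row k 0 j * sign_row k 0 j = 1.
Proof. by rewrite mxE; case: ifP; rewrite ?mulrNN mulr1. Qed.

Lemma flip_mx2 k : flip_mx k *m flip_mx k = 1%:M.
Proof.
rewrite /flip_mx mul_mx_diag; apply/matrixP => i j; rewrite !mxE.
have := sign_sq k j; rewrite mxE.
by case: (i =P j) => [->|_] /=; rewrite ?mulr1n ?mulr0n ?mul0r.
Qed.

Lemma flip_mxC k k' : flip_mx k *m flip_mx k' = flip_mx k' *m flip_mx k.
Proof. exact: diag_mxC. Qed.

Lemma T_group_flip k : T_group (flip_mx k).
Proof.
split; last by rewrite det_diag prod_sign.
split; first by rewrite tr_diag_mx flip_mx2.
move=> v [v1 vp]; rewrite /flip_mx mul_mx_diag; split=> [j|].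
  rewrite !mxE; case: ifP => _; rewrite ?mulr1 ?mulrN1; first exact: v1.
  by case: (v1 j) => ->; rewrite ?opprK; auto.
under eq_bigr do rewrite mxE.
by rewrite big_split /= vp prod_sign mulr1.
Qed.

Let neq1N1 : (1 : F) <> -1.
Proof. by move/eqP; rewrite -addr_eq0 (_ : 1 + 1 = 2%:R) // pnatr_eq0. Qed.

Lemma flip_mx_inj : injective flip_mx.
Proof.
by move=> k k' /matrixP/(_ k k); rewrite !mxE !eqxx !mulr1n; case: eqP.
Qed.

Lemma flip_mx_neq1 k : flip_mx k <> 1%:M.
Proof.
have [j jk] : exists j : 'I_3, j != k.
  have [->|k0] := eqVneq k 0; [by exists (inord 1); rewrite -val_eqE /= inordK|].
  by exists 0; rewrite eq_sym.
move/matrixP/(_ j j); rewrite !mxE !eqxx !mulr1n (negbTE jk) => /esym.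
exact: neq1N1.
Qed.

Lemma T_group1 : T_group (1%:M : 'M[F]_3).
Proof.
split; last exact: det1.
by split=> [|v]; [rewrite trmx1 mulmx1 | rewrite mulmx1].
Qed.

End TetrahedralGroup.

(** * The group of orientation-preserving automorphisms *)

Section DeckGroup.
Variable G : cmap.

Definition rotation_set : {set {perm G}} :=
  [set h : {perm G} | [forall d,
    (h (alpha d) == alpha (h d)) && (h (sigma d) == sigma (h d))]].

Lemma rotationP (h : {perm G}) : reflect (is_iso false h) (h \in rotation_set).
Proof.
rewrite inE; apply: (iffP forallP) => [hh|[_ ha hs] d]; last by rewrite ha hs !eqxx.
split; first by exists (h^-1)%g; [exact: permK | exact: permKV].
  by move=> d; have /andP[/eqP] := hh d.
by move=> d; have /andP[_ /eqP] := hh d.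
Qed.

Lemma rotation_group_set : group_set rotation_set.
Proof.
apply/group_setP; split; first by rewrite inE; apply/forallP => d;
  rewrite !perm1 !eqxx.
move=> g h /rotationP[_ ga gs] /rotationP[_ ha hs].
by rewrite inE; apply/forallP => d; rewrite !permM ga ha gs hs !eqxx.
Qed.

Definition rotations : {group {perm G}} := group rotation_group_set.

(** Both groups contain the rotations of the tetrahedron, and determinant 1 makes these come from
    orientation-preserving automorphisms. The elements chosen suffice to show that 12 divides the
    order of the rotation group. *)
Lemma T_symmetry_rotations (R : rcfType) :
  symmetry_group_is G (@T_group R) \/ symmetry_group_is G (@Td_group R) ->
  exists a b c : {perm G},
    [/\ [/\ a \in rotations, b \in rotations & c \in rotations],
        #[a] = 3, #[b] = 2, #[c] = 2 & commute b c /\ b != c]%g.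
Proof.
move=> hsym.
have [P [hP [rho [rhoM rho_inj rho_det rhoP]]]] : exists P : 'M[R]_3 -> Prop,
    (forall A, T_group A -> P A) /\ symmetry_group_is G P.
  case: hsym => h; first by exists (@T_group R).
  by exists (@Td_group R); split=> // A [].
have lift A : T_group A -> exists2 h : {perm G}, is_iso false h & rho h false = A.
  move=> TA; have /rhoP[f [b [fb E]]] := hP A TA.
  have := rho_det f b fb; rewrite E; case: TA => _ ->.
  case: b fb E => fb E; last by exists f.
  rewrite expr1 => /eqP; rewrite -addr_eq0 (_ : 1 + 1 = 2%:R)%R //.
  by rewrite pnatr_eq0.
have iso1 : is_iso false (1%g : {perm G}) by apply/rotationP;
  exact: (group1 rotations).
have isoM (f g : {perm G}) : is_iso false f -> is_iso false g ->
  is_iso false (f * g)%g.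
  by move=> /rotationP hf /rotationP hg; apply/rotationP;
    exact: (@groupM _ rotations).
have M (f g : {perm G}) : is_iso false f -> is_iso false g ->
    rho (f * g)%g false = (rho f false *m rho g false)%R.
  by move=> hf hg; have := rhoM f g false false hf hg.
have inj (f g : {perm G}) : is_iso false f -> is_iso false g ->
  rho f false = rho g false -> f = g.
  by move=> hf hg /(rho_inj f g false false hf hg)[].
(* A preimage of the identity matrix is idempotent, hence trivial. *)
have rho1 : rho 1%g false = 1%:M%R.
  have [e ie Ee] := lift _ (T_group1 R).
  have e1 : (e * e)%g = e by apply: inj => //;
    [exact: isoM | rewrite M // Ee mulmx1].
  have -> : 1%g = e by apply: (mulgI e); rewrite mulg1 e1.
  exact: Ee.
have [a ia Ea] := lift _ (T_group_cyclic R).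
have [b ib Eb] := lift _ (T_group_flip R ord0).
have [c ic Ec] := lift _ (T_group_flip R ord_max).
exists a, b, c; split.
- by split; apply/rotationP.
- apply: nt_prime_order => //.
    by apply: inj; rewrite ?expgS ?expg0 ?mulg1 ?rho1 ?M ?Ea ?mulmxA
      ?cyclic_mx3; auto.
  by apply/eqP => a1; apply: (@cyclic_mx_neq1 R); rewrite -Ea a1.
- apply: nt_prime_order => //.
    by apply: inj; rewrite ?expgS ?expg0 ?mulg1 ?rho1 ?M ?Eb ?flip_mx2; auto.
  by apply/eqP => b1; apply: (@flip_mx_neq1 R ord0); rewrite -Eb b1.
- apply: nt_prime_order => //.
    by apply: inj; rewrite ?expgS ?expg0 ?mulg1 ?rho1 ?M ?Ec ?flip_mx2; auto.
  by apply/eqP => c1; apply: (@flip_mx_neq1 R ord_max); rewrite -Ec c1.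
split; first by apply: inj; rewrite ?M ?Eb ?Ec ?(flip_mxC _ ord_max); auto.
by apply/eqP => bc; have /flip_mx_inj :=
  etrans (esym Eb) (etrans (congr1 (rho^~ false) bc) Ec).
Qed.

End DeckGroup.

Section DeckAction.
Variable G : cmap.
Hypothesis hG : self_hedrite4 G.
Notation H := (rotations G).
Variables a b c : {perm G}.
Hypotheses (aH : a \in H) (bH : b \in H) (cH : c \in H).
Hypotheses (ord_a : #[a]%g = 3) (ord_b : #[b]%g = 2) (ord_c : #[c]%g = 2).
Hypotheses (bcC : commute b c) (b_neq_c : b != c).

Let pG : plane_graph G. Proof. by case: hG. Qed.

Lemma rotation_alpha h (x : G) : h \in H -> h (alpha x) = alpha (h x).
Proof. by case/rotationP. Qed.

Lemma rotation_sigma h (x : G) : h \in H -> h (sigma x) = sigma (h x).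
Proof. by case/rotationP. Qed.

Lemma rotation_phi h (x : G) : h \in H -> h (phi x) = phi (h x).
Proof.
move=> hH; apply: (pg_sigma pG).
by rewrite -rotation_sigma // !(sigma_phi hG) rotation_alpha.
Qed.

(** The darts fixed by [h] are stable under [sigma] and [alpha], and the map is connected. *)
Lemma rotation_free h (x : G) : h \in H -> h x = x -> h = 1%g.
Proof.
move=> hH hx; apply/permP => y; rewrite perm1.
have /connectP[s] := (pg_connected pG).2 x y.
elim: s x hx => [|z s IH] x hx /=; first by move=> _ ->.
move=> /andP[/orP[] /eqP <- ps E]; apply: (IH _ _ ps E).
  by rewrite rotation_sigma // hx.
by rewrite rotation_alpha // hx.
Qed.

(** A Klein four-group, which turns out to be a Sylow 2-subgroup of [H]. *)
Let V := (<[b]> <*> <[c]>)%G.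

Let card_V : #|V| = 4.
Proof.
rewrite /= cent_joinEr; last by rewrite cent_cycle cycle_subG; apply/cent1P.
rewrite TI_cardMg; first by rewrite -!orderE ord_b ord_c.
apply: prime_TIg; first by rewrite -orderE ord_b.
rewrite cycle_subG; apply/negP => /cycleP[i Eb].
move: Eb b_neq_c ord_b;
  rewrite (divn_eq i 2) expgD mulnC expgM -{1}ord_c expg_order expg1n mul1g.
have: i %% 2 < 2 by rewrite ltn_mod.
case: (i %% 2) => [|[|//]] _ ->; last by rewrite expg1 eqxx.
by rewrite order1.
Qed.

Let V_sub : V \subset H.
Proof. by rewrite join_subG !cycle_subG bH cH. Qed.

Let V2 v : v \in V -> (v ^+ 2 = 1)%g.
Proof.
rewrite /= cent_joinEr; last by rewrite cent_cycle cycle_subG; apply/cent1P.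
move=> /mulsgP[_ _ /cycleP[i ->] /cycleP[j ->] ->].
rewrite expgMn; last by apply/commuteX2.
by rewrite !(expgAC _ _ 2) -{1}ord_b -{1}ord_c !expg_order !expg1n mulg1.
Qed.

Let card_H_ge : 12 %| #|H|.
Proof.
rewrite (@Gauss_dvd 3 4) //; apply/andP; split.
  by rewrite -ord_a; apply: order_dvdG.
by rewrite -card_V; apply: cardSg V_sub.
Qed.

Lemma rotation_orbit_inj x : {in H &, injective (fun h : {perm G} => h x)}.
Proof.
move=> g h gH hH E; apply: (mulIg h^-1%g); rewrite mulgV.
apply: (@rotation_free _ x); first by rewrite groupM ?groupV.
by rewrite permM E permK.
Qed.

Section CyclicOrder.
Variable f : G -> G.
Hypotheses (finj : injective f) (f_rot : forall h x, h \in H -> h (f x) = f (h x)).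
Hypothesis f34 : forall x, fingraph.order f x = 3 \/ fingraph.order f x = 4.
Hypothesis card3 : #|order_set f 3| = 12.

Let orbit_sub x : fingraph.order f x = 3 ->
  (fun h : {perm G} => h x) @: H \subset [set y | y \in order_set f 3].
Proof.
move=> fx; apply/subsetP=> _ /imsetP[h hH ->]; rewrite !inE.
have it n : iter n f (h x) = h (iter n f x) by elim: n => //= n ->; rewrite f_rot.
apply/eqP/order_eqP => //; last by rewrite it -fx iter_order.
move=> m /andP[m0 m3]; rewrite it => /perm_inj /(order_min m0).
by rewrite fx leqNgt m3.
Qed.

(** [H] acts freely on the 12 darts in cycles of length 3, so it has at most 12 elements; and 12
    divides its order. *)
Lemma card_rotations : #|H| = 12.
Proof.
have /card_gt0P[x] : 0 < #|order_set f 3| by rewrite card3.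
rewrite inE => /eqP fx; have := subset_leq_card (orbit_sub fx).
rewrite cardsE card_in_imset ?card3; last exact: rotation_orbit_inj.
move=> le12; apply/eqP; rewrite eqn_leq le12 dvdn_leq //; exact: cardG_gt0.
Qed.

(** The free action on the 12 darts in 3-cycles is transitive, so [f x] is in the orbit of [x].
    Conversely, in a 4-cycle such an [h] would have order 4, so [V] would be conjugate to a cyclic
    group by Sylow; but [V] has exponent 2. *)
Lemma order3_rotation x : iter 3 f x = x <-> exists2 h, h \in H & f x = h x.
Proof.
split=> [f3|[h hH E]].
  have fx : fingraph.order f x = 3.
    by case: (f34 x) => // f4; have := order_min (isT : 0 < 3) f3; rewrite f4.
  have E : (fun h : {perm G} => h x) @: H = [set y | y \in order_set f 3].
    apply/eqP; rewrite eqEcard (orbit_sub fx) cardsE card3.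
    by rewrite card_in_imset ?card_rotations //; apply: rotation_orbit_inj.
  have /imsetP[h hH ->] : f x \in (fun h : {perm G} => h x) @: H.
    by rewrite E !inE order_iter // fx.
  by exists h.
case: (f34 x) => fx; first by rewrite -fx iter_order.
exfalso.
have it n : iter n f x = (h ^+ n)%g x.
  elim: n => [|n IH]; first by rewrite expg0 perm1.
  by rewrite iterS IH expgS permM -E -f_rot // groupX.
have h4 : (h ^+ 4 = 1)%g.
  apply: (@rotation_free _ x); first by rewrite groupX.
  by rewrite -it -fx iter_order.
have h2 : (h ^+ 2 != 1)%g.
  apply/eqP => h2; have := it 2; rewrite h2 perm1 => /(order_min (isT : 0 < 2)).
  by rewrite fx.
have oh : #[h]%g = 4.
  have : #[h]%g %| 4 by rewrite order_dvdn h4.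
  have : ~~ (#[h]%g %| 2) by rewrite order_dvdn.
  by case: #[h]%g => [|[|[|[|[|n]]]]].
have syl (K : {group {perm G}}) : K \subset H -> #|K| = 4 -> (2.-Sylow(H) K)%g.
  by move=> KH K4; rewrite pHallE KH K4 card_rotations p_part.
have sh : (2.-Sylow(H) <[h]>)%g by apply: syl; rewrite ?cycle_subG.
have sV : (2.-Sylow(H) V)%g by apply: syl.
have [x0 x0H EV] := Sylow_trans sV sh.
have /V2 : (h ^ x0^-1)%g \in V by rewrite -mem_conjg -EV cycle_id.
rewrite -conjXg => /eqP; rewrite -(inj_eq (conjg_inj x0)) conjgKV conj1g.
exact/negP.
Qed.
End CyclicOrder.
End DeckAction.

(** * Isomorphisms of maps and inverse medial graphs *)

Section Isomorphic.

Lemma isomorphic_trans (G H K : cmap) :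
  isomorphic G H -> isomorphic H K -> isomorphic G K.
Proof.
move=> [b [f [bf fa fs]]] [c [g [bg ga gs]]]; exists (b (+) c), (g \o f); split.
- exact: bij_comp.
- by move=> d /=; rewrite fa ga.
move=> d /=; case: b c fs gs => -[] /= fs gs.
- by rewrite -[in RHS]fs gs.
- by rewrite -gs fs.
- by rewrite fs gs.
- by rewrite fs gs.
Qed.

Lemma isomorphic_sym (G H : cmap) : injective (@sigma H) ->
  isomorphic G H -> isomorphic H G.
Proof.
move=> sinj [b [f [[g fK gK] fa fs]]]; exists b, g; split.
- by exists f.
- by move=> e; apply: (can_inj fK); rewrite fa !gK.
case: b fs => fs e; apply: (can_inj fK); last by rewrite fs !gK.
by apply: sinj; rewrite fs !gK.
Qed.

Lemma med_half_isomorphic (M K : cmap) (F : {set M}) (rev : bool) (pr : M -> K) :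
  (forall q, q \in F -> phi q \in F) ->
  (forall q, q \in F -> sigma (sigma q) \in F) ->
  {in F &, injective pr} -> (forall x, exists2 q, q \in F & pr q = x) ->
  (forall q, q \in F -> pr (sigma (sigma q)) = alpha (pr q)) ->
  (forall q, q \in F ->
     if rev then sigma (pr (phi q)) = pr q else pr (phi q) = sigma (pr q)) ->
  isomorphic (med_half F) K.
Proof.
move=> Fphi Fsig inj surj pa ps.
exists rev, (fun d : med_half F => pr (val d)); split.
- have surj' x : exists d : med_half F, pr (val d) == x.
    by have [q qF <-] := surj x; exists (exist _ q qF : half_dart F).
  exists (fun x => xchoose (surj' x)) => [d|x];
    last exact: (eqP (xchooseP (surj' x))).
  apply: val_inj; apply: inj; [exact: valP|exact: valP|].
  exact: (eqP (xchooseP (surj' _))).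
- by move=> d; rewrite /= /half_alpha insubdK ?pa //;
  [exact: valP | apply/Fsig/valP].
move=> d; have := ps _ (valP d).
by rewrite /= /half_sigma insubdK //; apply/Fphi/valP.
Qed.

End Isomorphic.

Section MedialInverse.
Variables (G : cmap) (k l : nat).
Hypothesis hG : self_hedrite4 G.

Let pG : plane_graph G. Proof. by case: hG. Qed.
Let alphaK : involutive (@alpha G) := pg_alpha pG.

(* The sides of the tiles dual to the medial graph: the tile of [(x, b)] is the
   edge of [x], and the target of this side is the vertex at [x] if [b] holds,
   the face at [x] otherwise. *)
Definition tile_turn (d : G * bool) : G * bool :=
  if d.2 then (alpha d.1, false) else (d.1, true).
Definition tile_cross (d : G * bool) : G * bool :=
  if d.2 then (alpha (sigma d.1), false) else (phi d.1, true).

Lemma tile_turn4 d : tile_turn (tile_turn (tile_turn (tile_turn d))) = d.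
Proof. by case: d => x []; rewrite /tile_turn /= alphaK. Qed.

Lemma tile_crossK : involutive tile_cross.
Proof.
case=> x []; rewrite /tile_cross /=; last by rewrite (sigma_phi hG) alphaK.
congr (_, _); apply: (pg_sigma pG); by rewrite (sigma_phi hG) alphaK.
Qed.

Lemma phi_alpha_sigma (x : G) : phi (alpha (sigma x)) = x.
Proof. by apply: (pg_sigma pG); rewrite (sigma_phi hG) alphaK. Qed.

Variable f : quad_dart k l -> G * bool.
Hypotheses (bf : bijective f) (f_alpha : forall q,
  f (quad_alpha q) = tile_cross (f q)).
Notation M := (GC_octahedron k l).

Let finj : injective f := bij_inj bf.

Let self_dualG : isomorphic G (dual G). Proof. by case: hG. Qed.

Lemma self_dual_sym : isomorphic (dual G) G.
Proof. by apply: isomorphic_sym; [exact: phi_inj hG | case: hG]. Qed.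

Section Direction.
Variables turn turnV : G * bool -> G * bool.
Hypothesis turnK : cancel turn turnV.
Hypothesis f_prev : forall q, f q = turn (f (quad_prev q)).

Lemma quad_sigma_inj : injective (@sigma (quadrangulation k l)).
Proof.
move=> q q' /(congr1 f); rewrite /= !f_alpha => /(inv_inj tile_crossK) E.
by apply: finj; rewrite f_prev [RHS]f_prev E.
Qed.

(** In the dual of the quadrangulation, [sigma] is the inverse of [quad_prev]. *)
Lemma develop_sigma (q : M) : f (sigma q) = turn (f q).
Proof.
have /= := f_finv quad_sigma_inj (quad_alpha q).
move/(congr1 f); rewrite !f_alpha => /(inv_inj tile_crossK) E.
by rewrite f_prev; congr (turn _).
Qed.

Lemma octahedron_sigma_inj : injective (@sigma M).
Proof.
by move=> q q' /(congr1 f); rewrite !develop_sigma => /(can_inj turnK)/finj.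
Qed.

Lemma develop_phi (q : M) : f (phi q) = turnV (tile_cross (f q)).
Proof.
by rewrite -f_alpha -[in RHS](f_finv octahedron_sigma_inj (quad_alpha q))
  develop_sigma turnK.
Qed.

End Direction.

Let F : {set M} := [set q | (f q).2].

Let in_F q : (q \in F) = (f q).2. Proof. by rewrite inE. Qed.

Let in_CF q : (q \in ~: F) = ~~ (f q).2. Proof. by rewrite !inE. Qed.

Let f_surj d : exists q, f q = d. Proof. by have [g _ gK] := bf; exists (g d). Qed.

Let f1_inj q q' : (f q).2 = (f q').2 -> (f q).1 = (f q').1 -> q = q'.
Proof. by move=> E2 E1; apply: finj;
  rewrite [LHS]surjective_pairing E1 E2 -surjective_pairing. Qed.

(** Through [f], [phi] of [M] acts as [sigma] of [G] on [F] and as [phi] of [G] on the complement.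
    So the halves are [G] and its dual, isomorphic by self-duality. *)
Lemma is_med_inv_direct : (forall q, f q = tile_turn (f (quad_prev q))) ->
  is_med_inv M G.
Proof.
move=> fp; pose tV d := tile_turn (tile_turn (tile_turn d)).
have tK : cancel tile_turn tV by move=> d; exact: tile_turn4.
have fs := develop_sigma fp; have fph := develop_phi tK fp.
have phiE (q : M) : f (phi q) = if (f q).2 then (sigma (f q).1,
  true) else (phi (f q).1, false).
  by rewrite fph; case: (f q) => x [];
    rewrite /tV /tile_turn /tile_cross /= !alphaK.
have sigE (q : M) : f (sigma (sigma q)) = (alpha (f q).1, (f q).2).
  by rewrite !fs; case: (f q) => x [].
have isoF : isomorphic (med_half F) G.
  apply: (@med_half_isomorphic M _ _ false (fun q : M => (f q).1)).
  - by move=> q; rewrite !in_F phiE => ->.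
  - by move=> q; rewrite !in_F sigE.
  - by move=> q q'; rewrite !in_F => h h'; apply: f1_inj; rewrite h h'.
  - by move=> x; have [q Eq] := f_surj (x, true); exists q; rewrite ?in_F Eq.
  - by move=> q; rewrite sigE.
  - by move=> q; rewrite in_F phiE => ->.
have isoCF : isomorphic (med_half (~: F)) (dual G).
  apply: (@med_half_isomorphic M (dual G) _ false (fun q : M => (f q).1 : dual G)).
  - by move=> q; rewrite !in_CF phiE => /negbTE ->.
  - by move=> q; rewrite !in_CF sigE.
  - by move=> q q'; rewrite !in_CF => /negbTE h /negbTE h'; apply: f1_inj;
    rewrite h h'.
  - by move=> x; have [q Eq] := f_surj (x, false); exists q; rewrite ?in_CF Eq.
  - by move=> q; rewrite sigE.
  - by move=> q; rewrite in_CF phiE => /negbTE ->.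
exists F; split.
- by move=> q; rewrite !in_F phiE f_alpha; case: (f q) => x [].
- apply: (isomorphic_trans isoF); apply: (isomorphic_trans self_dualG).
  by apply: (isomorphic_sym _ isoCF); exact: phi_inj hG.
- exact: (isomorphic_sym (pg_sigma pG) isoF).
Qed.

(** With turns reversed, [phi] of [M] acts on [F] as the inverse of [phi] of [G], and on the
    complement as a conjugate of the inverse of [sigma]. The halves are the dual of [G] and [G],
    with orientation reversed. *)
Lemma is_med_inv_mirror :
  (forall q, f q = tile_turn (tile_turn (tile_turn (f (quad_prev q))))) ->
    is_med_inv M G.
Proof.
move=> fp; pose tV d := tile_turn (tile_turn (tile_turn d)).
have tK : cancel tV tile_turn by move=> d; exact: tile_turn4.
have fs := develop_sigma (turn := tV) fp; have fph := develop_phi tK fp.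
have phiE (q : M) : f (phi q) =
    if (f q).2 then (alpha (sigma (f q).1), true) else (alpha (phi (f q).1), false).
  by rewrite fph; case: (f q) => x [].
have sigE (q : M) : f (sigma (sigma q)) = (alpha (f q).1, (f q).2).
  by rewrite !fs; case: (f q) => x []; rewrite /tV /tile_turn /= !alphaK.
have isoF : isomorphic (med_half F) (dual G).
  apply: (@med_half_isomorphic M (dual G) _ true (fun q : M => (f q).1 : dual G)).
  - by move=> q; rewrite !in_F phiE => ->.
  - by move=> q; rewrite !in_F sigE.
  - by move=> q q'; rewrite !in_F => h h'; apply: f1_inj; rewrite h h'.
  - by move=> x; have [q Eq] := f_surj (x, true); exists q; rewrite ?in_F Eq.
  - by move=> q; rewrite sigE.
  - by move=> q; rewrite in_F phiE => -> /=; apply: phi_alpha_sigma.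
have isoCF : isomorphic (med_half (~: F)) G.
  (* Conjugating [x |-> alpha (phi x)] by [alpha] gives [x |-> phi (alpha x)], the inverse of
     [sigma]. *)
  apply: (@med_half_isomorphic M _ _ true (fun q : M => alpha (f q).1)).
  - by move=> q; rewrite !in_CF phiE => /negbTE ->.
  - by move=> q; rewrite !in_CF sigE.
  - move=> q q'; rewrite !in_CF => /negbTE h /negbTE h' /(inv_inj alphaK).
    by apply: f1_inj; rewrite h h'.
  - move=> x; have [q Eq] := f_surj (alpha x, false).
    by exists q; rewrite ?in_CF Eq //= alphaK.
  - by move=> q; rewrite sigE.
  - by move=> q; rewrite in_CF phiE => /negbTE -> /=; rewrite alphaK (sigma_phi hG).
have isoFG := isomorphic_trans isoF self_dual_sym.
exists F; split.
- by move=> q; rewrite !in_F phiE f_alpha; case: (f q) => x [].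
- exact: (isomorphic_trans isoFG (isomorphic_sym (pg_sigma pG) isoCF)).
- exact: (isomorphic_sym (pg_sigma pG) isoFG).
Qed.

End MedialInverse.

(** * Application to self-hedrites with tetrahedral symmetry *)

Section SelfHedriteTiling.
Variables (R : rcfType) (G : cmap).
Hypothesis hG : self_hedrite4 G.
Hypothesis hsym : symmetry_group_is G (@T_group R) \/ symmetry_group_is G
  (@Td_group R).

Let pG : plane_graph G. Proof. by case: hG. Qed.
Let alphaK : involutive (@alpha G) := pg_alpha pG.
Notation S := (spin (@tile_turn G) (@tile_cross G)).

Let act (h : {perm G}) (d : G * bool) : G * bool := (h d.1, d.2).

(** The side [(x, true)] ends at a vertex of [G], so it starts at a face, about which [spin] turns
    as [phi]. About a vertex, [spin] is [sigma] conjugated by [alpha]. *)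
Let spin_face x : S (x, true) = (phi x, true).
Proof. by rewrite /spin /tile_turn /tile_cross /= alphaK. Qed.

Let spin_vertex x : S (x, false) = (alpha (sigma (alpha x)), false).
Proof. by []. Qed.

Let iter_spin_face n x : iter n S (x, true) = (iter n phi x, true).
Proof. by elim: n => //= n ->; rewrite spin_face. Qed.

Let iter_spin_vertex n x :
  iter n S (x, false) = (alpha (iter n sigma (alpha x)), false).
Proof. by elim: n => [|n IH]; rewrite ?iterS ?IH ?spin_vertex ?alphaK. Qed.

Let face_order3 x : iter 3 phi x = x <-> exists2 h, h \in rotations G & phi x = h x.
Proof.
have [a [b [c [[aH bH cH] oa ob oc [bc nbc]]]]] := T_symmetry_rotations hsym.
apply: (order3_rotation hG aH bH cH oa ob oc bc nbc) (phi_inj hG) _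
  (face_size34 hG) _ x.
  by move=> h y /(rotation_phi hG y).
exact: card_triangle_darts.
Qed.

Let vertex_order3 x : iter 3 sigma x = x <-> exists2 h,
  h \in rotations G & sigma x = h x.
Proof.
have [a [b [c [[aH bH cH] oa ob oc [bc nbc]]]]] := T_symmetry_rotations hsym.
apply: (order3_rotation hG aH bH cH oa ob oc bc nbc) (pg_sigma pG) _
  (vertex_degree34 hG) _ x.
  by move=> h y /(rotation_sigma y).
exact: card_trivalent_darts.
Qed.

Let card_rot : #|rotations G| = 12.
Proof.
have [a [b [c [[aH bH cH] oa ob oc [bc nbc]]]]] := T_symmetry_rotations hsym.
apply: (card_rotations hG aH bH cH oa ob oc bc nbc) (phi_inj hG) _ _.
  by move=> h y /(rotation_phi hG y).
exact: card_triangle_darts.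
Qed.

Let tile_connected (P : G * bool -> Prop) : (exists d, P d) ->
  (forall d, P d -> P (tile_turn d)) -> (forall d, P d -> P (tile_cross d)) ->
  forall d, P d.
Proof.
move=> [[x0 b0] Px0] PR PA.
have Pf x : P (x, true) -> P (x, false).
  by move/PR/PR/PR; rewrite /tile_turn /= alphaK.
have Pt x : P (x, false) -> P (x, true) by move/PR.
have Pa x : P (x, true) -> P (alpha x, true) by move/PR/PR.
have Ps x : P (x, true) -> P (sigma x, true).
  by move/PA/Pt/Pa; rewrite /= alphaK.
have {b0 Px0} : P (x0, true) by case: b0 Px0 => // /Pt.
move=> Px0 [y b]; suff : P (y, true) by case: b => // /Pf.
have /connectP[s] := (pg_connected pG).2 x0 y.
elim: s x0 Px0 => [|z s IH] x0 Px0 /=; first by move=> _ ->.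
by move=> /andP[/orP[] /eqP <- ps E]; apply: (IH _ _ ps E); auto.
Qed.

(** Rotations act on the first component of a side, and the colour [d.2] tells vertices of [G] from
    faces. Trivalent vertices and triangles provide cones of both colours. *)
Lemma self_hedrite_tiling : exists k l : nat, [/\ l < k, odd (k + l) &
  is_med_inv (GC_octahedron k l) G].
Proof.
have [] := @tetrahedral_tiling (G * bool)%type (@tile_turn G) (@tile_cross G) _
  (rotations G) act (tile_turn4 hG) (tile_crossK hG) _ _ _ _ _ card_rot _ _
  tile_connected (fun d => d.2).
- by case=> x b; rewrite /act perm1.
- by move=> g h [x b] _ _; rewrite /act permM.
- by move=> h [x []] hH; rewrite /act /tile_turn /= ?rotation_alpha.
- move=> h [x []] hH; rewrite /act /tile_cross /=.
    by rewrite rotation_alpha // rotation_sigma.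
  by rewrite (rotation_phi hG).
- by move=> h [x b] hH [/(rotation_free hG hH)].
- case=> x [].
    case: (face_size34 hG x) => E; [left|right].
      by rewrite -[LHS]/(iter 3 _ _) iter_spin_face -E iter_order //;
        exact: phi_inj.
    by rewrite -[LHS]/(iter 4 _ _) iter_spin_face -E iter_order //; exact: phi_inj.
  case: (vertex_degree34 hG (alpha x)) => E; [left|right].
    rewrite -[LHS]/(iter 3 _ _) iter_spin_vertex -E iter_order ?alphaK //;
      exact: pg_sigma pG.
  rewrite -[LHS]/(iter 4 _ _) iter_spin_vertex -E iter_order ?alphaK //;
    exact: pg_sigma pG.
- case=> x b; rewrite -[S (S (S _))]/(iter 3 S (x, b)).
  case: b.
    rewrite iter_spin_face spin_face; split=> [[/face_order3[h hH E]]|[h hH [E]]].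
      by exists h; rewrite // /act E.
    by congr (_, _); apply/face_order3; exists h.
  rewrite iter_spin_vertex spin_vertex.
  split=> [[/(congr1 alpha)]|[h hH [/(congr1 alpha)]]].
    rewrite alphaK => /vertex_order3[h hH E].
    by exists h; rewrite // /act E rotation_alpha // alphaK.
  rewrite alphaK -rotation_alpha // => E.
  have -> : iter 3 sigma (alpha x) = alpha x by apply/vertex_order3; exists h.
  by rewrite alphaK.
- by case=> x [].
- by case=> x [].
- by [].
- case.
    have /card_gt0P[x] : 0 < #|order_set (@phi G) 3| by rewrite
      (card_triangle_darts hG).
    rewrite inE => /eqP E; exists (x, true) => //.
    by rewrite -[LHS]/(iter 3 _ _) iter_spin_face -E iter_order //; exact: phi_inj.
  have /card_gt0P[x] : 0 < #|order_set (@sigma G) 3| by rewrite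
    (card_trivalent_darts hG).
  rewrite inE => /eqP E; exists (alpha x, false) => //.
  rewrite -[LHS]/(iter 3 _ _) iter_spin_vertex alphaK -E iter_order //;
    exact: pg_sigma pG.
move=> k [l [ltlk okl [[f [bf fa fp]]|[f [bf fa fp]]]]]; exists k, l; split=> //.
  exact: (is_med_inv_direct hG bf fa fp).
exact: (is_med_inv_mirror hG bf fa fp).
Qed.

End SelfHedriteTiling.

Theorem theorem5 (R : rcfType) (G : cmap) (hG : self_hedrite4 G)
    (hsym : symmetry_group_is G (@T_group R) \/
            symmetry_group_is G (@Td_group R)) :
  exists k l : nat,
    [/\ l <= k, odd (k + l) & is_med_inv (GC_octahedron k l) G].
Proof.
have [k [l [ltlk okl med]]] := self_hedrite_tiling hG hsym.
by exists k, l; split=> //; apply: ltnW.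
Qed.
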